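(* Let $\mathcal{A}$ and $\mathcal{B}$ be essential $d$-arrangements of homotopy spheres such that $L(\mathcal{A})\cong L(\mathcal{B})$ (as lattices). Then $\mathcal{A}$ and $\mathcal{B}$ are homotopy equivalent arrangements.
   Context: A homotopy $k$-sphere is a $k$-dimensional CW-complex homotopy equivalent to the sphere $S^k$; by convention the empty set is a homotopy $(-1)$-sphere (of dimension $-1$). A $d$-arrangement of homotopy spheres consists of a homotopy $d$-sphere $S$ and a finite set $\mathcal{A}=\{S_1,\dots,S_n\}$ of subcomplexes of $S$, each a homotopy $(d-1)$-sphere, such that (a) every intersection of members of $\mathcal{A}$ is a homotopy sphere; (b) if $X$ is an intersection of members of $\mathcal{A}$ which is a $d'$-dimensional homotopy sphere and $X\nsubseteq S_j$, then $X\cap S_j$ is a $(d'-1)$-dimensional homotopy sphere. $\mathcal{A}$ is essential if $\bigcap_j S_j=\emptyset$. The intersection lattice $L(\mathcal{A})$ is the poset of all intersections of members of $\mathcal{A}$, ordered by reverse inclusion, with $S$ included as the empty intersection. Let $\mathcal{A}=\{S_1,\dots,S_n\}$ and $\mathcal{B}=\{T_1,\dots,T_n\}$ be $d$-arrangements of homotopy spheres with ambient homotopy spheres $S$ and $T$. They are homotopy equivalent arrangements if there exist a lattice isomorphism $\phi:L(\mathcal{A})\to L(\mathcal{B})$ and homotopy equivalences $f:S\to T$, $g:T\to S$ such that: (1) for each $X\in L(\mathcal{A})$, $f(X)\subseteq\phi(X)$ and $f:X\to\phi(X)$ is a homotopy equivalence; (2) for each $Y\in L(\mathcal{B})$, $g(Y)\subseteq\phi^{-1}(Y)$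 and $g:Y\to\phi^{-1}(Y)$ is a homotopy equivalence. *)

(* Defs.v *)
From HB Require Import structures.
From mathcomp Require Import all_boot all_order all_algebra.
From mathcomp Require Import all_classical all_reals all_analysis.
Import Order.TTheory GRing.Theory Num.Theory.
Import numFieldNormedType.Exports.

Set Implicit Arguments.
Unset Strict Implicit.
Unset Printing Implicit Defensive.

Local Open Scope classical_set_scope.
Local Open Scope ring_scope.

(* Euclidean unit sphere and disks: the norm on 'rV[R]_n provided by the
   library is the sup norm, so the squared Euclidean norm is spelled out. *)

Definition sqnorm2 (R : realType) (n : nat) (x : 'rV[R]_n) : R :=
  \sum_(i < n) x ord0 i ^+ 2.

Definition unit_disk (R : realType) (n : nat) : set 'rV[R]_n :=
  [set x | sqnorm2 x <= 1].
Arguments unit_disk : clear implicits.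

Definition open_unit_disk (R : realType) (n : nat) : set 'rV[R]_n :=
  [set x | sqnorm2 x < 1].
Arguments open_unit_disk : clear implicits.

(* [unit_sphere R n] lives in R^n: it is S^(n-1). *)
Definition unit_sphere (R : realType) (n : nat) : set 'rV[R]_n :=
  [set x | sqnorm2 x = 1].
Arguments unit_sphere : clear implicits.

Definition homotopic (R : realType) (X Y : topologicalType) (f g : X -> Y) :=
  exists H : X * R -> Y,
    [/\ {within setT `*` `[0, 1]%classic, continuous H},
        forall x, H (x, 0) = f x & forall x, H (x, 1) = g x].

Definition homotopy_equivalence (R : realType) (X Y : topologicalType)
    (f : X -> Y) :=
  continuous f /\
  exists g : Y -> X,
    [/\ continuous g, homotopic R (g \o f) id & homotopic R (f \o g) id].

(* Subsets, seen as types, carry the subspace topology. *)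
Definition homotopy_equivalence_on (R : realType) (S T : topologicalType)
    (X : set S) (Y : set T) (f : S -> T) :=
  exists h : X -> Y,
    (forall x : X, set_val (h x) = f (set_val x)) /\ homotopy_equivalence R h.

(* J. H. C. Whitehead's intrinsic definition: a Hausdorff space partitioned into
   open cells with characteristic maps, closure-finite, with the weak topology.
   There may be infinitely many cells, and the space may be empty. *)
Record cw_complex (R : realType) (S : topologicalType) := CWComplex {
  cw_cell : Type;
  cw_dim : cw_cell -> nat;
  cw_map : forall e : cw_cell, 'rV[R]_(cw_dim e) -> S;
  cw_open_cell := fun e => @cw_map e @` open_unit_disk R (cw_dim e);
  cw_closed_cell := fun e => @cw_map e @` unit_disk R (cw_dim e);
  cw_hausdorff : hausdorff_space S;
  cw_map_continuous : forall e,
    {within unit_disk R (cw_dim e), continuous (@cw_map e)};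
  cw_map_homeo : forall e, exists g : S -> 'rV[R]_(cw_dim e),
    {within cw_open_cell e, continuous g} /\
    {in open_unit_disk R (cw_dim e), cancel (@cw_map e) g};
  cw_cover : \bigcup_e cw_open_cell e = setT;
  cw_disjoint : trivIset setT cw_open_cell;
  cw_closure_finite : forall e, exists F : set cw_cell,
    [/\ finite_set F,
        forall e', F e' -> (cw_dim e' < cw_dim e)%N &
        @cw_map e @` unit_sphere R (cw_dim e)
          `<=` \bigcup_(e' in F) cw_open_cell e'];
  cw_weak_topology : forall Z : set S,
    (forall e, closed (Z `&` cw_closed_cell e)) -> closed Z
}.

Definition subcomplex (R : realType) (S : topologicalType)
    (K : cw_complex R S) (X : set S) :=
  closed X /\ exists E : set (cw_cell K), X = \bigcup_(e in E) cw_open_cell e.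

Definition cw_dimension (R : realType) (S : topologicalType)
    (K : cw_complex R S) (X : set S) (k : nat) :=
  (forall e : cw_cell K, cw_open_cell e `<=` X -> (cw_dim e <= k)%N) /\
  (exists e : cw_cell K, cw_open_cell e `<=` X /\ cw_dim e = k).

(* The subcomplex X is a homotopy k-sphere, k an integer; [Negz 0] is -1. *)
Definition homotopy_sphere (R : realType) (S : topologicalType)
    (K : cw_complex R S) (k : int) (X : set S) :=
  subcomplex K X /\
  match k with
  | Posz n => cw_dimension K X n /\
      exists f : X -> unit_sphere R n.+1, homotopy_equivalence R f
  | Negz 0 => X = set0
  | Negz _.+1 => False
  end.

(* The intersection of the empty subfamily is the whole space. *)
Definition is_intersection (T : Type) (A : set (set T)) (X : set T) :=
  exists2 F : set (set T), F `<=` A & X = \bigcap_(Y in F) Y.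

Record sphere_arrangement (R : realType) (d : int) (S : topologicalType)
    (K : cw_complex R S) (A : set (set S)) : Prop := SphereArrangement {
  arr_ambient : homotopy_sphere K d setT;
  arr_finite : finite_set A;
  arr_member : forall X, A X -> homotopy_sphere K (d - 1) X;
  arr_intersection : forall X, is_intersection A X ->
    exists k : int, homotopy_sphere K k X;
  arr_cut : forall X k Y, is_intersection A X -> homotopy_sphere K k X ->
    A Y -> ~ X `<=` Y -> homotopy_sphere K (k - 1) (X `&` Y)
}.

Definition essential (T : Type) (A : set (set T)) :=
  \bigcap_(X in A) X = set0.

Record intersection_lattice (T : Type) (A : set (set T)) := Intersection {
  isect_set :> set T;
  isect_proof : is_intersection A isect_set
}.

Fact intersection_display : Order.disp_t. Proof. by []. Qed.

Section IntersectionLattice.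
Variables (T : Type) (A : set (set T)).
Local Notation L := (intersection_lattice A).
Implicit Types X Y Z : L.

Lemma isect_set_inj (X Y : L) : X = Y :> set T -> X = Y.
Proof.
case: X Y => [X pX] [Y pY] /= XY; case: _ / XY in pY *.
by congr Intersection; exact: Prop_irrelevance.
Qed.

HB.instance Definition _ := gen_eqMixin L.
HB.instance Definition _ := gen_choiceMixin L.

Definition isect_le X Y := `[< isect_set Y `<=` isect_set X >].

Fact isect_le_refl : reflexive isect_le.
Proof. by move=> X; apply/asboolP. Qed.

Fact isect_le_anti : antisymmetric isect_le.
Proof.
move=> X Y /andP[/asboolP YX /asboolP XY].
by apply: isect_set_inj; apply/seteqP.
Qed.

Fact isect_le_trans : transitive isect_le.
Proof.
move=> Y X Z /asboolP YX /asboolP ZY.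
by apply/asboolP; exact: subset_trans ZY YX.
Qed.

HB.instance Definition _ := Order.Le_isPOrder.Build intersection_display L
  isect_le_refl isect_le_anti isect_le_trans.

Fact is_intersectionI X Y : is_intersection A (isect_set X `&` isect_set Y).
Proof.
have [F FA ->] := isect_proof X; have [G GA ->] := isect_proof Y.
exists (F `|` G); first by move=> Z [/FA|/GA].
by rewrite bigcap_setU.
Qed.

Definition isect_join X Y : L := Intersection (is_intersectionI X Y).

(* The smallest intersection containing X and Y: for reverse inclusion, their
   meet. *)
Fact is_intersection_hull X Y : is_intersection A
  (\bigcap_(Z in [set Z | A Z /\ isect_set X `|` isect_set Y `<=` Z]) Z).
Proof. by eexists; last reflexivity; move=> Z []. Qed.

Definition isect_meet X Y : L := Intersection (is_intersection_hull X Y).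

Fact isect_meetP X Y Z :
  (X <= isect_meet Y Z)%O = (X <= Y)%O && (X <= Z)%O.
Proof.
apply/idP/andP => [/asboolP|[/asboolP YX /asboolP ZX]].
  move=> sX; split; apply/asboolP => t Yt; apply: sX => W [_]; apply.
    by left.
  by right.
apply/asboolP; have [F FA XE] := isect_proof X.
move=> t tI; rewrite XE => W FW.
apply: (tI W); split; first exact: FA.
by move=> s [/YX|/ZX]; rewrite XE; apply.
Qed.

Fact isect_joinP X Y Z :
  (isect_join X Y <= Z)%O = (X <= Z)%O && (Y <= Z)%O.
Proof.
apply/asboolP/andP => [sZ|[/asboolP ZX /asboolP ZY] t Zt].
  by split; apply/asboolP => t /sZ[].
by split; [exact: ZX | exact: ZY].
Qed.

HB.instance Definition _ :=
  Order.POrder_MeetJoin_isLattice.Build intersection_display L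
    isect_meetP isect_joinP.

End IntersectionLattice.

(* The cardinality condition: the two arrangements are indexed by the same
   1, ..., n. *)
Definition homotopy_equivalent_arrangements (R : realType)
    (S T : topologicalType) (A : set (set S)) (B : set (set T)) :=
  (A #= B)%card /\
  exists (phi : {lmorphism intersection_lattice A -> intersection_lattice B})
         (psi : intersection_lattice B -> intersection_lattice A)
         (f : S -> T) (g : T -> S),
    [/\ cancel phi psi /\ cancel psi phi,
        homotopy_equivalence R f,
        homotopy_equivalence R g,
        forall X : intersection_lattice A,
          homotopy_equivalence_on R X (phi X) f &
        forall Y : intersection_lattice B,
          homotopy_equivalence_on R Y (psi Y) g].

(* Main.v *)
Require Import Defs.
From mathcomp Require Import all_boot all_order all_algebra.
From mathcomp Require Import all_classical all_reals all_analysis.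
From mathcomp Require Import ring lra zify.

(** The map is built intersection by intersection, from the small ones to the
whole sphere, so that everything rests on one step: a homotopy [k]-sphere [X], a
homotopy [k]-sphere [Y], a subcomplex [V] of [X] with cells of dimension less
than [k] (the union of the smaller intersections inside [X]) and a continuous
map [f] from [V] to [Y].  The claim is that [f] extends to a homotopy
equivalence from [X] to [Y] ([extend_to_equivalence]).

This needs neither homology nor degrees.  Take any homotopy equivalence [h] from
[X] to [Y], one exists as both are equivalent to [S^k].  Since [V] has dimension
less than [k], two maps from [V] to [S^k] are always homotopic
([sphere_maps_homotopic]), so that [f] is homotopic to the restriction of [h].
By the homotopy extension property ([homotopy_extension]) the homotopy spreads
over [X] and deforms [h] into an extension of [f], again an equivalence.

Both facts are obtained by extending a map over the cylinders of the cells, in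
the order of dimensions ([extend_cells]); complexes may be infinite, and
continuity on a cylinder over the complex is recovered from the cells by a tube
argument ([cellwise_continuous]).  For homotopy extension a single cell is
handled by the retraction of a cylinder to its bottom and side.  For maps into
[S^k] it is handled by [sphere_extension]: on a compact set of dimension at most
[k], maps into [S^k] extend from closed subsets.  Its source is a counting
argument: the image of such a set under a Lipschitz map into Euclidean space of
dimension [k + 1] misses points arbitrarily close to the origin
([lipschitz_misses]).

On the combinatorial side, every cover in an intersection lattice drops the
dimension by one, so that a lattice isomorphism preserves dimensions
([iso_dimension]); and the members of an arrangement are the atoms of its
lattice, so that the two arrangements have equally many members
([iso_card_le]). *)

Import Order.TTheory GRing.Theory Num.Theory.
Import numFieldNormedType.Exports.

Set Implicit Arguments.
Unset Strict Implicit.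
Unset Printing Implicit Defensive.

Local Open Scope classical_set_scope.
Local Open Scope ring_scope.

(** * Maps continuous on a subset, and their homotopies *)

Lemma within_comp (U V W : topologicalType) (A : set U) (B : set V)
    (f : U -> V) (g : V -> W) :
  (forall x, A x -> B (f x)) -> {within A, continuous f} ->
  {within B, continuous g} -> {within A, continuous (g \o f)}.
Proof.
move=> AB /subspace_continuousP cf /subspace_continuousP cg.
apply/subspace_continuousP => x Ax.
apply: cvg_trans (cg _ (AB _ Ax)) => P /=; rewrite /nbhs/= => h.
have := cf x Ax _ h; rewrite /nbhs/=; rewrite /within/= => h'.
by apply: filterS h' => y hy Ay; apply: hy => //; apply: AB.
Qed.

Lemma within_pair (U V W : topologicalType) (A : set U)
    (f : U -> V) (g : U -> W) :
  {within A, continuous f} -> {within A, continuous g} ->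
  {within A, continuous (fun x => (f x, g x))}.
Proof.
move=> /subspace_continuousP cf /subspace_continuousP cg.
by apply/subspace_continuousP => x Ax; apply: cvg_pair; [exact: cf|exact: cg].
Qed.

Lemma within_eq (U V : topologicalType) (A : set U) (f g : U -> V) :
  (forall x, A x -> f x = g x) -> {within A, continuous f} ->
  {within A, continuous g}.
Proof.
by move=> fg; apply: subspace_eq_continuous => x; rewrite inE => /fg.
Qed.

Lemma within_fst (U V : topologicalType) (A : set (U * V)) :
  {within A, continuous fst}.
Proof. by apply: continuous_subspaceT => [a b]; exact: cvg_fst. Qed.

Lemma within_snd (U V : topologicalType) (A : set (U * V)) :
  {within A, continuous snd}.
Proof. by apply: continuous_subspaceT => [a b]; exact: cvg_snd. Qed.

Lemma closed_setX (U V : topologicalType) (A : set U) (B : set V) :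
  closed A -> closed B -> closed (A `*` B).
Proof.
move=> cA cB; have -> : A `*` B = (fst @^-1` A) `&` (snd @^-1` B) by [].
by apply: closedI; apply: preimage_closed => // -[a b] _; [exact: cvg_fst|exact: cvg_snd].
Qed.

Lemma set_val_continuous (U : topologicalType) (A : set U) :
  continuous (set_val : A -> U).
Proof. exact: initial_continuous. Qed.

Lemma within_set_type (U V : topologicalType) (A : set U) (B : set V)
    (f : U -> B) :
  {within A, continuous (set_val \o f)} -> {within A, continuous f}.
Proof.
move=> /subspace_continuousP cf; apply/subspace_continuousP => x Ax P /=.
case=> Q [[W oW <-] /= Wfx sP].
have h : nbhs ((set_val \o f) x) W by apply: open_nbhs_nbhs; split.
have := cf x Ax _ h; rewrite /nbhs/= /within /= => h'.
by apply: filterS h' => y hy Ay; apply: sP; exact: hy.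
Qed.

(** The pasting lemma for a domain [A] that need not be closed, such as the
cylinder over an arbitrary set, which is cut at half time below. *)
Lemma within_paste (U V : topologicalType) (A P Q : set U) (f : U -> V) :
  closed P -> closed Q -> A `<=` P `|` Q ->
  {within A `&` P, continuous f} -> {within A `&` Q, continuous f} ->
  {within A, continuous f}.
Proof.
have half (C : set U) x W : closed C -> {within A `&` C, continuous f} ->
    A x -> nbhs (f x) W -> \forall y \near x, A y -> C y -> W (f y).
  move=> cC /subspace_continuousP cf Ax fW.
  have [Cx|nCx] := pselect (C x).
    have := cf x (conj Ax Cx) _ fW; rewrite /nbhs/= /within/= => h.
    by apply: filterS h => y h Ay Cy; exact: h.
  have : nbhs x (~` C) by apply: open_nbhs_nbhs; split=> //; exact: closed_openC.
  by apply: filterS => y nCy _ /nCy.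
move=> cP cQ APQ fP fQ; apply/subspace_continuousP => x Ax W fW.
rewrite /nbhs/= /within/=; near=> y => Ay.
have [Py|Qy] := APQ _ Ay.
  by move: Ay Py; near: y; exact: half.
by move: Ay Qy; near: y; exact: half.
Unshelve. all: by end_near. Qed.

Section homotopic_on.
Variable R : realType.
Local Notation I := (`[0, 1]%classic : set R).

Definition homotopic_on (U V : topologicalType) (A : set U) (f g : U -> V) :=
  exists H : U * R -> V,
    [/\ {within A `*` I, continuous H},
        forall x, A x -> H (x, 0) = f x & forall x, A x -> H (x, 1) = g x].

Lemma homotopic_onT (U V : topologicalType) (f g : U -> V) :
  homotopic R f g <-> homotopic_on setT f g.
Proof.
by split=> -[H [cH H0 H1]]; exists H; split=> // x; [exact: H0|exact: H1].
Qed.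

Lemma in_unit (t : R) : I t <-> 0 <= t <= 1.
Proof. by rewrite /= in_itv. Qed.

Lemma closed_unit : closed I.
Proof. exact: interval_closed. Qed.

Lemma homotopic_on_refl (U V : topologicalType) (A : set U) (f : U -> V) :
  {within A, continuous f} -> homotopic_on A f f.
Proof.
move=> cf; exists (f \o fst); split=> //.
by apply: (within_comp (B := A) _ (@within_fst _ _ _) cf) => -[x t] [].
Qed.

Lemma homotopic_on_sym (U V : topologicalType) (A : set U) (f g : U -> V) :
  homotopic_on A f g -> homotopic_on A g f.
Proof.
move=> [H [cH H0 H1]]; exists (H \o (fun p => (p.1, 1 - p.2))); split.
- apply: (within_comp (B := A `*` I)) cH.
    by move=> [x t] [/= Ax /in_unit t01]; split=> //=;
      apply/in_unit; lra.
  apply: within_pair; first exact: within_fst.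
  apply: continuous_subspaceT => -[a b]; apply: cvgB; first exact: cvg_cst.
  exact: cvg_snd.
- by move=> x Ax /=; rewrite subr0; exact: H1.
- by move=> x Ax /=; rewrite subrr; exact: H0.
Qed.

Lemma homotopic_on_trans (U V : topologicalType) (A : set U)
    (g f h : U -> V) :
  homotopic_on A f g -> homotopic_on A g h -> homotopic_on A f h.
Proof.
move=> [H [cH H0 H1]] [G [cG G0 G1]].
(* [H] on the first half of the time interval, [G] on the second *)
pose F p := if p.2 <= 2^-1 :> R then H (p.1, 2 * p.2) else G (p.1, 2 * p.2 - 1).
exists F; split; last 2 first.
- by move=> x Ax; rewrite /F /= ifT ?mulr0 ?H0// invr_ge0.
- move=> x Ax; rewrite /F /= ifF ?mulr1; last by apply/negbTE; rewrite -ltNge; lra.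
  by rewrite (_ : 2 - 1 = 1) ?G1//; lra.
pose P1 : set (U * R) := snd @^-1` [set t | t <= 2^-1].
pose P2 : set (U * R) := snd @^-1` [set t | 2^-1 <= t].
have cP1 : closed P1 by apply: preimage_closed; [move=> -[a b] _; exact: cvg_snd|exact: closed_le].
have cP2 : closed P2 by apply: preimage_closed; [move=> -[a b] _; exact: cvg_snd|exact: closed_ge].
have c1 : {within (A `*` I) `&` P1, continuous F}.
  apply: (@within_eq _ _ _ (H \o (fun p => (p.1, 2 * p.2)))).
    by move=> [x t] [_ /= t2]; rewrite /F /= ifT.
  apply: (within_comp (B := A `*` I)) cH.
    move=> [x t] [[/= Ax /in_unit t01]]; rewrite /P1 /= => t2.
    by split=> //=; apply/in_unit; lra.
  apply: within_pair; first exact: within_fst.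
  apply: continuous_subspaceT => -[a b]; apply: cvgM; first exact: cvg_cst.
  exact: cvg_snd.
have c2 : {within (A `*` I) `&` P2, continuous F}.
  apply: (@within_eq _ _ _ (G \o (fun p => (p.1, 2 * p.2 - 1)))).
    move=> [x t] [[/= Ax _] /= t2]; rewrite /F /=; case: ifPn => // t2'.
    have -> : t = 2^-1 by apply/le_anti; rewrite t2 t2'.
    by rewrite divff// subrr G0// H1.
  apply: (within_comp (B := A `*` I)) cG.
    move=> [x t] [[/= Ax /in_unit t01]]; rewrite /P2 /= => t2.
    by split=> //=; apply/in_unit; lra.
  apply: within_pair; first exact: within_fst.
  apply: continuous_subspaceT => -[a b]; apply: cvgB; last exact: cvg_cst.
  by apply: cvgM; [exact: cvg_cst|exact: cvg_snd].
apply: within_paste cP1 cP2 _ c1 c2 => -[x t] _; rewrite /P1 /P2 /=.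
by case: (leP t 2^-1) => [|/ltW]; [left|right].
Qed.

Lemma homotopic_on_compl (U V W : topologicalType) (A : set U) (f g : U -> V)
    (h : V -> W) :
  continuous h -> homotopic_on A f g -> homotopic_on A (h \o f) (h \o g).
Proof.
move=> ch [H [cH H0 H1]]; exists (h \o H); split.
- by apply: (within_comp (B := setT)) cH _ => //; exact: continuous_subspaceT.
- by move=> x Ax /=; rewrite H0.
- by move=> x Ax /=; rewrite H1.
Qed.

Lemma homotopic_on_compr (U V W : topologicalType) (A : set U) (B : set V)
    (f g : V -> W) (h : U -> V) :
  {within A, continuous h} -> (forall x, A x -> B (h x)) ->
  homotopic_on B f g -> homotopic_on A (f \o h) (g \o h).
Proof.
move=> ch AB [H [cH H0 H1]]; exists (H \o (fun p => (h p.1, p.2))); split.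
- apply: (within_comp (B := B `*` I)) cH.
    by move=> [x t] [/= /AB].
  apply: within_pair; last exact: within_snd.
  by apply: (within_comp (B := A) _ (@within_fst _ _ _) ch) => -[x t] [].
- by move=> x Ax /=; rewrite H0//; exact: AB.
- by move=> x Ax /=; rewrite H1//; exact: AB.
Qed.

(** * Homotopy equivalences *)

Lemma homotopic_sym (U V : topologicalType) (f g : U -> V) :
  homotopic R f g -> homotopic R g f.
Proof. by rewrite !homotopic_onT; exact: homotopic_on_sym. Qed.

Lemma homotopic_trans (U V : topologicalType) (g f h : U -> V) :
  homotopic R f g -> homotopic R g h -> homotopic R f h.
Proof. by rewrite !homotopic_onT; exact: homotopic_on_trans. Qed.

Lemma homotopic_comp2 (U V W : topologicalType) (f f' : U -> V)
    (g g' : V -> W) : continuous f -> continuous g' ->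
  homotopic R f f' -> homotopic R g g' -> homotopic R (g \o f) (g' \o f').
Proof.
rewrite !homotopic_onT => cf cg ff gg; apply: (@homotopic_on_trans _ _ _ (g' \o f)).
  by apply: homotopic_on_compr gg => //; exact: continuous_subspaceT.
exact: homotopic_on_compl.
Qed.

Lemma homotopic_refl (U V : topologicalType) (f : U -> V) :
  continuous f -> homotopic R f f.
Proof.
move=> cf; rewrite homotopic_onT.
by apply: homotopic_on_refl; exact: continuous_subspaceT.
Qed.

Lemma continuous_compose (U V W : topologicalType) (f : U -> V) (g : V -> W) :
  continuous f -> continuous g -> continuous (g \o f).
Proof. by move=> cf cg x; apply: continuous_comp; [exact: cf|exact: cg]. Qed.

Lemma continuous_idfun (U : topologicalType) : continuous (@id U).
Proof. by move=> x; exact: cvg_id. Qed.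

Lemma homotopy_equivalence_sym (U V : topologicalType) (f : U -> V) :
  homotopy_equivalence R f -> exists g : V -> U,
    [/\ homotopy_equivalence R g, homotopic R (g \o f) id
       & homotopic R (f \o g) id].
Proof. by case=> cf [g [cg gf fg]]; exists g; split=> //; split=> //; exists f. Qed.

Lemma homotopy_equivalence_comp (U V W : topologicalType) (f : U -> V)
    (g : V -> W) : homotopy_equivalence R f -> homotopy_equivalence R g ->
  homotopy_equivalence R (g \o f).
Proof.
case=> cf [f' [cf' f'f ff']] [cg [g' [cg' g'g gg']]].
split; first exact: continuous_compose.
exists (f' \o g'); split; first exact: continuous_compose.
- apply: homotopic_trans f'f.
  apply: (@homotopic_comp2 _ _ _ f f (f' \o (g' \o g)) f') => //.
    exact: homotopic_refl.
  apply: (@homotopic_comp2 _ _ _ (g' \o g) id f' f') => //.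
    exact: continuous_compose.
  exact: homotopic_refl.
- apply: homotopic_trans gg'.
  apply: (@homotopic_comp2 _ _ _ g' g' (g \o (f \o f')) g) => //.
    exact: homotopic_refl.
  apply: (@homotopic_comp2 _ _ _ (f \o f') id g g) => //.
    exact: continuous_compose.
  exact: homotopic_refl.
Qed.

Lemma homotopy_equivalence_homotopic (U V : topologicalType) (f g : U -> V) :
  continuous g -> homotopic R f g -> homotopy_equivalence R f ->
  homotopy_equivalence R g.
Proof.
move=> cg fg [cf [h [ch hf fh]]]; split=> //; exists h; split=> //.
- apply: homotopic_trans hf; apply: homotopic_sym.
  by apply: (@homotopic_comp2 _ _ _ f g h h) => //; exact: homotopic_refl.
- apply: homotopic_trans fh; apply: homotopic_sym.
  by apply: (@homotopic_comp2 _ _ _ h h f g) => //; exact: homotopic_refl.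
Qed.

Lemma homeomorphism_equivalence (U V : topologicalType) (f : U -> V)
    (g : V -> U) : continuous f -> continuous g -> cancel f g -> cancel g f ->
  homotopy_equivalence R f.
Proof.
move=> cf cg fK gK; split=> //; exists g; split=> //.
- by rewrite (_ : g \o f = id); [exact/homotopic_refl/continuous_idfun|exact/funext].
- by rewrite (_ : f \o g = id); [exact/homotopic_refl/continuous_idfun|exact/funext].
Qed.

End homotopic_on.

(** * Extending maps into a sphere from subsets of low dimension *)

Section sphere_extension.
Variable R : realType.

(** The infimal convolution of [f] with the cone [L * `|x|] is [L]-Lipschitz, and
lies between [f - e] and [f] on [E] once [L] is large enough. *)
Lemma lipschitz_approx (Z : normedModType R) (E : set Z) (f : Z -> R) (e : R) :
  compact E -> continuous f -> 0 < e ->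
  exists (g : Z -> R) (L : R), [/\ 0 <= L,
    forall x y, `|g x - g y| <= L * `|x - y| &
    forall x, E x -> `|f x - g x| <= e].
Proof.
move=> cE cf e0.
have [E0|/set0P E0] := eqVneq E set0.
  by exists (fun=> 0), 0; split=> // [x y|x]; rewrite ?subrr ?normr0 ?mul0r// E0.
have cff : continuous (fun p : Z * Z => `|f p.1 - f p.2|).
  move=> -[a b]; apply: (@cvg_norm _ R^o); apply: (@cvgB _ R^o).
    by apply: continuous_comp; [exact: cvg_fst|exact: cf].
  by apply: continuous_comp; [exact: cvg_snd|exact: cf].
have cd : continuous (fun p : Z * Z => `|p.1 - p.2|).
  by move=> -[a b]; apply: cvg_norm; apply: cvgB; [exact: cvg_fst|exact: cvg_snd].
have cEE : compact (E `*` E) by exact: compact_setX.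
have EE0 : E `*` E !=set0 by case: E0 => x Ex; exists (x, x).
(* The pairs where [f] varies by at least [e] form a compact set [K] off the
   diagonal; its distance to the diagonal bounds the slope that is needed. *)
have [L L0 HL] : exists2 L, 0 <= L &
    forall x y, E x -> E y -> f x <= f y + L * `|x - y| + e.
  pose K := (E `*` E) `&` (fun p => `|f p.1 - f p.2|) @^-1` [set t | e <= t].
  have cK : compact K.
    apply: compact_closedI => //; apply: preimage_closed; last exact: closed_ge.
    by move=> x _; exact: cff.
  have [K0|/set0P K0] := eqVneq K set0.
    exists 0 => // x y Ex Ey; rewrite mul0r addr0 -lerBlDl.
    rewrite (le_trans (ler_norm _))// leNgt; apply/negP => /ltW h.
    by have : K (x, y) by []; rewrite K0.
  have [p0 /set_mem Kp0 p0min] :=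
    compact_EVT_min K0 cK (continuous_subspaceT cd).
  have [p1 /set_mem Kp1 p1max] :=
    compact_EVT_max EE0 cEE (continuous_subspaceT cff).
  have d0 : 0 < `|p0.1 - p0.2|.
    rewrite normr_gt0 subr_eq0; apply/eqP => h.
    by case: Kp0 => _ /=; rewrite h subrr normr0 leNgt e0.
  exists (`|f p1.1 - f p1.2| / `|p0.1 - p0.2|); first by rewrite divr_ge0.
  move=> x y Ex Ey; have [h|h] := leP e (`|f x - f y|).
    have /p0min /= le1 : (x, y) \in K by apply/mem_set.
    have /p1max /= le2 : (x, y) \in E `*` E by apply/mem_set.
    apply: (@le_trans _ _ (f y + `|f p1.1 - f p1.2|)).
      by rewrite -lerBlDl (le_trans (ler_norm _)).
    rewrite -addrA lerD2l; apply: ler_wpDr; first exact: ltW.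
    by rewrite mulrAC ler_pdivlMr// ler_wpM2l.
  have := le_lt_trans (ler_norm _) h.
  rewrite ltrBlDl => /ltW h'; apply: (le_trans h'); rewrite lerD2r lerDl.
  by rewrite mulr_ge0// divr_ge0.
have [m /set_mem Em mmin] := compact_EVT_min E0 cE (continuous_subspaceT cf).
pose S x := (fun y => f y + L * `|x - y|) @` E.
have Slb x : lbound (S x) (f m).
  by move=> _ [y Ey <-]; rewrite ler_wpDr ?mmin ?mulr_ge0//; exact/mem_set.
have Slb' x : has_lbound (S x) by exists (f m); exact: Slb.
have S0 x : S x !=set0 by case: E0 => y Ey; eexists; exists y.
exists (fun x => inf (S x)), L; split=> //.
  have half x y : inf (S x) <= inf (S y) + L * `|x - y|.
    rewrite -lerBlDr; apply: lb_le_inf => // _ [z Ez <-].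
    rewrite lerBlDr; apply: (@le_trans _ _ (f z + L * `|x - z|)).
      by apply: ge_inf => //; exists z.
    rewrite -addrA lerD2l -mulrDr ler_wpM2l//.
    by rewrite [leRHS]addrC; exact: ler_distD.
  move=> x y; have := half x y; have := half y x.
  by rewrite (distrC y) ler_norml => h1 h2; lra.
move=> x Ex; rewrite ger0_norm ?subr_ge0.
  rewrite lerBlDl -lerBlDr; apply: lb_le_inf => // _ [y Ey <-].
  by rewrite lerBlDr; exact: HL.
have : S x (f x + L * `|x - x|) by exists x.
by rewrite subrr normr0 mulr0 addr0 => /(ge_inf (Slb' x)).
Qed.

(** Upper box dimension at most [n]. *)
Definition box_dim_le (Z : normedModType R) (E : set Z) (n : nat) :=
  exists C : nat, forall N : nat, (0 < N)%N -> exists (J : finType) (c : Z -> J),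
    (#|J| <= (C * N) ^ n)%N /\
    forall x y, E x -> E y -> c x = c y -> `|x - y| <= N%:R^-1.

(** A fine grid of the cube has more points than [E] has boxes of comparable
size, so that a Lipschitz map cannot reach all of them. *)
Lemma lipschitz_misses (Z : normedModType R) (E : set Z) (n q : nat)
    (g : 'I_q -> Z -> R) (L e : R) :
  box_dim_le E n -> (n < q)%N -> 0 <= L -> 0 < e ->
  (forall i x y, `|g i x - g i y| <= L * `|x - y|) ->
  exists2 p : 'I_q -> R, (forall i, `|p i| <= e) &
    forall x, E x -> exists i, g i x != p i.
Proof.
move=> [C HC] nq L0 e0 gL; apply: contrapT => noP.
(* If no point is missed, every point of the cube has a preimage in [E]. *)
have hit (p : 'I_q -> R) : exists x, (forall i, `|p i| <= e) ->
    E x /\ forall i, g i x = p i.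
  have [pe|npe] := pselect (forall i, `|p i| <= e); last by exists 0 => /npe.
  apply: contrapT => nx; apply: noP; exists p => // x Ex.
  apply: contrapT => h; apply: nx; exists x => _; split=> // i.
  by apply/eqP/negPn/negP => gp; apply: h; exists i.
have [z zP] := choice hit.
pose c := (Num.bound (L / e)).+1.
(* With this [c], boxes of size [1 / (c * M)] have images smaller than the mesh
   [e / M] of the grid. *)
have cL : L < e * c%:R.
  have := archi_boundP (divr_ge0 L0 (ltW e0)).
  rewrite ltr_pdivrMr// mulrC => /lt_le_trans; apply.
  by rewrite ler_wpM2l ?ler_nat// ltW.
have c0 : (0 < c)%N by [].
clearbody c; have [M ME] : exists M, M = ((C * c) ^ n).+1 by eexists.
have M0 : 0 < M%:R :> R by rewrite ltr0n ME.
have [|J [k [cardJ kP]]] := HC (c * M)%N; first by rewrite muln_gt0 c0 ME.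
pose p (a : {ffun 'I_q -> 'I_M.+1}) (i : 'I_q) : R := e * (a i)%:R / M%:R.
have pe a i : `|p a i| <= e.
  rewrite /p ger0_norm; last by rewrite divr_ge0 ?mulr_ge0// ltW.
  rewrite -mulrA ler_piMr ?(ltW e0)// ler_pdivrMr// mul1r ler_nat.
  by rewrite -ltnS.
(* Distinct grid points have preimages in distinct boxes. *)
have inj : injective (k \o (z \o p)).
  move=> a b /= kab; apply/ffunP => i; apply/val_inj => /=.
  have [Ea ga] := zP (p a) (pe a); have [Eb gb] := zP (p b) (pe b).
  have := gL i (z (p a)) (z (p b)); rewrite ga gb => h1.
  have h2 := le_trans h1 (ler_wpM2l L0 (kP _ _ Ea Eb kab)).
  have : `|(a i)%:R - (b i)%:R| < 1 :> R.
    move: h2; rewrite /p -mulrBl -mulrBr !normrM normfV (gtr0_norm e0) (gtr0_norm M0).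
    rewrite ler_pdivrMr// natrM invfM => h2.
    have : e * `|(a i)%:R - (b i)%:R| < e * 1.
      apply: (le_lt_trans h2); rewrite mulr1 mulrA mulrAC -mulrA divff ?gt_eqF// mulr1.
      by rewrite ltr_pdivrMr ?ltr0n.
    by rewrite ltr_pM2l.
  rewrite ltr_norml => /andP[h3 h4].
  have h5 : ((b i) < (a i).+1)%N by rewrite -(ltr_nat R) -natr1; lra.
  have h6 : ((a i) < (b i).+1)%N by rewrite -(ltr_nat R) -natr1; lra.
  by apply/eqP; rewrite eqn_leq -ltnS h6 -ltnS h5.
have := leq_card _ inj; rewrite card_ffun !card_ord => h.
have {h} h := leq_trans h cardJ; move: h; rewrite leqNgt => /negP; apply.
(* [M] exceeds the constant [(C * c) ^ n], so that [M.+1 ^ n.+1] grid points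
   outnumber [(C * c * M) ^ n] boxes. *)
rewrite mulnA expnMn; apply: leq_trans (leq_pexp2l _ nq) => //.
rewrite expnS; apply: (@leq_ltn_trans (M * M ^ n)).
  by rewrite leq_mul2r ME leqnSn orbT.
apply: (@leq_trans (M.+1 * M ^ n)).
  by rewrite ltn_pmul2r// expn_gt0 ME.
rewrite leq_mul2l; apply/orP; right; case: (n) => [|m]; rewrite ?expn0//.
by rewrite leq_exp2r// leqnSn.
Qed.

Lemma row_continuous (U : topologicalType) (n : nat) (h : 'I_n -> U -> R) :
  (forall i, continuous (h i)) -> continuous (fun x => \row_i h i x).
Proof.
move=> ch x; apply/cvg_ballP => e e0.
have : \forall y \near x, forall i : 'I_n, ball (h i x) e (h i y).
  by apply: filter_forall => i; exact: (cvg_ball (ch i x)).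
apply: filterS => y hy; split=> // i j; rewrite !mxE; exact: hy.
Qed.

Lemma sqnorm2_continuous n : continuous (@sqnorm2 R n).
Proof.
move=> x; rewrite /sqnorm2.
apply: cvg_big; [exact: add_continuous|exact: (nbhs_filter x)|move=> i _].
apply: (@continuous_comp _ _ _ (fun x : 'rV[R]_n => x ord0 i) (fun t => t ^+ 2)).
  exact: coord_continuous.
exact: exprn_continuous.
Qed.

Lemma sqnorm2_ge0 n (x : 'rV[R]_n) : 0 <= sqnorm2 x.
Proof. by apply: sumr_ge0 => i _; exact: sqr_ge0. Qed.

Lemma sqnorm2Z n a (x : 'rV[R]_n) : sqnorm2 (a *: x) = a ^+ 2 * sqnorm2 x.
Proof. by rewrite /sqnorm2 mulr_sumr; apply: eq_bigr => i _; rewrite mxE exprMn. Qed.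

Lemma sqr_coord_le n (x : 'rV[R]_n) i : x ord0 i ^+ 2 <= sqnorm2 x.
Proof. by rewrite /sqnorm2 (bigD1 i)//= lerDl sumr_ge0// => j _; exact: sqr_ge0. Qed.

Lemma sqnorm2_gt0 n (x : 'rV[R]_n) : (0 < sqnorm2 x) = (x != 0).
Proof.
rewrite lt_neqAle sqnorm2_ge0 andbT eq_sym; congr negb; apply/eqP/eqP => [x0|->].
  apply/rowP => i; rewrite mxE; apply/eqP; rewrite -sqrf_eq0 eq_le sqr_ge0 andbT.
  by rewrite -x0 sqr_coord_le.
by rewrite /sqnorm2 big1// => i _; rewrite mxE expr0n.
Qed.

Definition direction n (x : 'rV[R]_n) := (Num.sqrt (sqnorm2 x))^-1 *: x.

Lemma direction_sphere n (x : 'rV[R]_n) : x != 0 -> unit_sphere R n (direction x).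
Proof.
rewrite -sqnorm2_gt0 => x0; rewrite /unit_sphere/= sqnorm2Z exprVn.
by rewrite sqr_sqrtr ?sqnorm2_ge0// mulVf// gt_eqF.
Qed.

Lemma direction_id n (x : 'rV[R]_n) : unit_sphere R n x -> direction x = x.
Proof. by rewrite /unit_sphere /direction /= => ->; rewrite sqrtr1 invr1 scale1r. Qed.

Lemma direction_continuous n (x : 'rV[R]_n) :
  x != 0 -> {for x, continuous (@direction n)}.
Proof.
move=> x0; rewrite /prop_for /continuous_at /direction.
apply: (@cvgZ _ _ _ (nbhs x) _ (fun x => (Num.sqrt (sqnorm2 x))^-1) id); last exact: cvg_id.
apply: cvgV; first by rewrite gt_eqF// sqrtr_gt0 sqnorm2_gt0.
by apply: continuous_comp; [exact: sqnorm2_continuous|exact: sqrt_continuous].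
Qed.

Lemma lipschitz_continuous (Z : normedModType R) (g : Z -> R) (L : R) :
  (forall x y, `|g x - g y| <= L * `|x - y|) -> continuous g.
Proof.
move=> gL x; apply/cvgrPdist_lt => e e0.
have M0 : 0 < `|L| + 1 by rewrite ltr_wpDl.
have : \forall y \near x, `|x - y| < e / (`|L| + 1).
  have h : 0 < e / (`|L| + 1) by rewrite divr_gt0.
  by have := nbhsx_ballx x _ h; rewrite -ball_normE.
apply: filterS => y; rewrite ltr_pdivlMr// => h; apply: (le_lt_trans (gL _ _)).
apply: le_lt_trans h; rewrite mulrC ler_wpM2l//.
by rewrite (le_trans (ler_norm _))// lerDl.
Qed.

(** A set of dimension at most [k] cannot wrap essentially around [S^k]: a map
from a closed subset to the sphere extends by Tietze to a map [phi] into the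
ambient Euclidean space, and next to [phi] there is a map [G], a translate of a
Lipschitz map, that avoids the origin on all of [E].  Interpolating from [phi] where it is
large to [G] where it is small gives an extension without zeros. *)
Theorem sphere_extension (Z : normedModType R) (E C : set Z) (n k : nat)
    (f : Z -> unit_sphere R k.+1) :
  compact E -> closed C -> box_dim_le E n -> (n <= k)%N ->
  {within C, continuous f} ->
  exists F : Z -> unit_sphere R k.+1,
    {within E, continuous F} /\ forall x, C x -> F x = f x.
Proof.
move=> cE clC dE nk cf.
pose fi i x : R := (set_val (f x)) ord0 i.
have fsphere x : unit_sphere R k.+1 (set_val (f x)) by exact: set_valP.
have fi1 i x : `|fi i x| <= 1.
  rewrite -(@ler_pXn2r _ 2)// ?nnegrE// expr1n real_normK ?num_real//.
  by rewrite (le_trans (sqr_coord_le _ _))// fsphere.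
have cfi i : {within C, continuous (fi i)}.
  pose h (y : unit_sphere R k.+1) := (set_val y) ord0 i.
  apply: (within_comp (B := setT) (g := h) _ cf) => //; apply: continuous_subspaceT.
  apply: (@continuous_compose _ _ _ set_val (fun v : 'rV[R]_k.+1 => v ord0 i)).
    exact: set_val_continuous.
  exact: coord_continuous.
have /choice[phi phiP] i : exists g : Z -> R, continuous g /\ forall x, C x -> fi i x = g x.
  have [g [fg cg _]] := continuous_bounded_extension pseudometric_normal clC ltr01 (cfi i) (fun x _ => fi1 i x).
  by exists g; split=> // x Cx; apply: fg; apply/mem_set.
(* small enough that a vector of [k.+1] coordinates at most [2 * d] has squared
   norm at most [1 / 2] *)
pose d : R := (4 * k.+1%:R)^-1.
have d0 : 0 < d by rewrite invr_gt0 mulr_gt0.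
have /choice[g /choice[L gP]] i : exists (g : Z -> R) (L : R), [/\ 0 <= L,
    forall x y, `|g x - g y| <= L * `|x - y| &
    forall x, E x -> `|phi i x - g x| <= d].
  by apply: lipschitz_approx => //; exact: (phiP i).1.
have [||p pd pg] := @lipschitz_misses Z E n k.+1 g (\sum_i L i) d dE nk _ d0.
- by apply: sumr_ge0 => i _; have [] := gP i.
- move=> i x y; have [_ gi _] := gP i; apply: (le_trans (gi x y)).
  rewrite ler_wpM2r// (bigD1 i)//= lerDl sumr_ge0// => j _.
  by have [] := gP j.
pose G i x : R := g i x - p i.
pose Phi x : 'rV[R]_k.+1 := \row_i phi i x.
(* 1 where [Phi] is on the sphere, 0 where its squared norm is at most [1 / 2] *)
pose lam x : R := Order.max 0 (Order.min 1 (2 * sqnorm2 (Phi x) - 1)).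
pose F0 x : 'rV[R]_k.+1 := \row_i (phi i x + (1 - lam x) * (G i x - phi i x)).
have F0n0 x : E x -> F0 x != 0.
  move=> Ex; apply/negP => /eqP F0x.
  have F0i i : phi i x + (1 - lam x) * (G i x - phi i x) = 0.
    by have := congr1 (fun v : 'rV_k.+1 => v ord0 i) F0x; rewrite !mxE.
  have [l0|l0] := leP (2 * sqnorm2 (Phi x)) 1.
    have lx : lam x = 0.
      by apply/max_idPl; rewrite ge_min subr_le0 l0 orbT.
    have [i] := pg _ Ex; have := F0i i; rewrite lx subr0 mul1r addrC subrK.
    by move=> /eqP; rewrite subr_eq0 => ->.
  have lx : 0 <= 1 - lam x <= 1.
    by rewrite subr_ge0 ge_max ler01 ge_min lexx /= gerBl le_max lexx.
  have phid i : phi i x ^+ 2 <= (2 * d) ^+ 2.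
    rewrite -[leLHS]real_normK ?num_real// ler_pXn2r// ?nnegrE ?mulr_ge0// ?(ltW d0)//.
    have -> : phi i x = - ((1 - lam x) * (G i x - phi i x)).
      by apply/eqP; rewrite -subr_eq0 opprK; apply/eqP.
    rewrite normrN normrM; apply: (@le_trans _ _ `|G i x - phi i x|).
      by rewrite ler_piMl// ger0_norm; case/andP: lx.
    have [_ _ /(_ x Ex)] := gP i; have := pd i; rewrite /G.
    move=> h1 h2; rewrite addrAC; apply: (le_trans (ler_normB _ _)).
    by rewrite distrC; lra.
  have : sqnorm2 (Phi x) <= \sum_(i < k.+1) (2 * d) ^+ 2.
    by apply: ler_sum => i _; rewrite mxE.
  rewrite sumr_const card_ord -mulr_natr => h.
  have : (2 * d) ^+ 2 * k.+1%:R <= 2^-1.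
    have K1 : 1 <= k.+1%:R :> R by rewrite ler1n.
    have dk : d * k.+1%:R = 4^-1 by rewrite /d invfM mulfVK// pnatr_eq0.
    have d1 : d <= 4^-1 by rewrite -dk ler_peMr// ltW.
    have -> : (2 * d) ^+ 2 * k.+1%:R = 4 * d * (d * k.+1%:R) by ring.
    by rewrite dk; lra.
  lra.
have clam : continuous lam.
  move=> x; apply: (@continuous_max R Z (cst 0)); first exact: cvg_cst.
  apply: (@continuous_min R Z (cst 1)); first exact: cvg_cst.
  apply: (@cvgB _ R^o); last exact: cvg_cst.
  apply: (@cvgM R); first exact: cvg_cst.
  apply: continuous_comp; last exact: sqnorm2_continuous.
  by apply: row_continuous => i; exact: (phiP i).1.
have cF0 : continuous F0.
  apply: row_continuous => i x; apply: (@cvgD _ R^o); first exact: (phiP i).1.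
  apply: (@cvgM R).
    by apply: (@cvgB _ R^o); [exact: cvg_cst|exact: clam].
  apply: (@cvgB _ R^o); last exact: (phiP i).1.
  apply: (@cvgB _ R^o); last exact: cvg_cst.
  have [_ gL _] := gP i; exact: lipschitz_continuous gL x.
pose F x := insubd (f x) (direction (F0 x)).
have FE x : F0 x != 0 -> set_val (F x) = direction (F0 x).
  move=> Fx; apply: (insubdK (f x)); apply/mem_set; exact: direction_sphere.
exists F; split.
  apply: within_set_type.
  have EF x : E x -> (@direction k.+1 \o F0) x = (set_val \o F) x.
    by move=> Ex /=; rewrite FE// F0n0.
  apply: (within_eq EF).
  apply: continuous_in_subspaceT => x /set_mem Ex.
  by apply: continuous_comp; [exact: cF0|apply: direction_continuous; exact: F0n0].
move=> x Cx; apply/val_inj.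
have Phix : Phi x = set_val (f x).
  by apply/rowP => i; rewrite mxE -(phiP i).2.
have F0x : F0 x = set_val (f x).
  have lx : lam x = 1.
    rewrite /lam Phix fsphere; apply/eqP.
    by rewrite (_ : 2 * 1 - 1 = 1) ?minxx ?max_r//; lra.
  by apply/rowP => i; rewrite mxE lx subrr mul0r addr0 -(phiP i).2.
have -> : \val (F x) = direction (F0 x).
  by apply: FE; rewrite F0x -sqnorm2_gt0 fsphere.
by rewrite F0x direction_id.
Qed.

End sphere_extension.

(** * Cylinders over disks *)

Section cylinders.
Variable R : realType.
Local Notation I := (`[0, 1]%classic : set R).

Lemma closed_unit_disk m : closed (unit_disk R m).
Proof.
have -> : unit_disk R m = @sqnorm2 R m @^-1` [set t | t <= 1] by [].
by apply: preimage_closed; [move=> x _; exact: sqnorm2_continuous|exact: closed_le].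
Qed.

Lemma closed_unit_sphere m : closed (unit_sphere R m).
Proof.
have -> : unit_sphere R m = @sqnorm2 R m @^-1` [set t | t = 1] by [].
by apply: preimage_closed; [move=> x _; exact: sqnorm2_continuous|exact: closed_eq].
Qed.

Lemma unit_sphere_disk m : unit_sphere R m `<=` unit_disk R m.
Proof. by move=> x; rewrite /unit_sphere /unit_disk /= => ->. Qed.

Lemma unit_disk_coord m (z : 'rV[R]_m) i : unit_disk R m z -> -1 <= z ord0 i <= 1.
Proof.
rewrite /unit_disk/= => z1; rewrite -ler_norml -(@ler_pXn2r _ 2)// ?nnegrE//.
by rewrite expr1n real_normK ?num_real// (le_trans (sqr_coord_le _ _)).
Qed.

Lemma compact_unit_disk m : compact (unit_disk R m).
Proof.
have Mnco : compact [set v : 'rV[R]_m | forall i, `[-1, 1]%classic (v ord0 i)].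
  apply: (@rV_compact R m (fun=> `[-1, 1]%classic)) => _; exact: segment_compact.
apply: subclosed_compact (@closed_unit_disk m) Mnco _ => v v1 i.
by rewrite /= in_itv/= unit_disk_coord.
Qed.

Lemma compact_cylinder m : compact (unit_disk R m `*` I).
Proof. by apply: compact_setX; [exact: compact_unit_disk|exact: segment_compact]. Qed.

Lemma rV_norm_le m (v : 'rV[R]_m) (a : R) :
  0 <= a -> (forall i, `|v ord0 i| <= a) -> `|v| <= a.
Proof.
move=> a0 va; rewrite [leLHS]/Num.norm/= mx_normrE; apply/bigmax_leP; split=> // -[i j] _ /=.
by rewrite ord1.
Qed.

Lemma box_dim_cylinder m :
  box_dim_le (unit_disk R m `*` I : set ('rV[R]_m * R)%type) m.+1.
Proof.
exists 3%N => N N0; have N0' : 0 < N%:R :> R by rewrite ltr0n.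
have N3 : (3 * N)%N = (3 * N).-1.+1 by rewrite prednK// muln_gt0.
pose q (s : R) : 'I_(3 * N).-1.+1 := inord (Num.truncn ((s + 1) * N%:R)).
have qP s s' : -1 <= s <= 1 -> -1 <= s' <= 1 -> q s = q s' -> `|s - s'| <= N%:R^-1.
  have tr x : -1 <= x <= 1 ->
      (q x : nat)%:R <= (x + 1) * N%:R < (q x : nat)%:R + 1.
    move=> x1; have h : 0 <= (x + 1) * N%:R by rewrite mulr_ge0//; lra.
    rewrite inordK ?natr1 ?truncn_itv// -N3 -(ltr_nat R).
    have /andP[h1 _] := truncn_itv h; apply: (le_lt_trans h1).
    by rewrite natrM ltr_pM2r//; lra.
  move=> /tr /andP[h1 h2] /tr /andP[h3 h4] qq; rewrite qq in h1 h2.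
  rewrite -[leRHS]mul1r ler_pdivlMr// -[X in _ * X](gtr0_norm N0') -normrM.
  by rewrite ler_norml; lra.
exists ({ffun 'I_m -> 'I_(3 * N).-1.+1} * 'I_(3 * N).-1.+1)%type.
exists (fun p : 'rV[R]_m * R => ([ffun i => q (p.1 ord0 i)], q p.2)); split.
  by rewrite card_prod card_ffun !card_ord -N3 expnSr.
move=> [z t] [z' t'] [/= Dz /in_unit t1] [/= Dz' /in_unit t1'] [/ffunP zz tt].
have N0i : 0 <= N%:R^-1 :> R by rewrite invr_ge0 ltW.
rewrite prod_normE /= ge_max; apply/andP; split; last by apply: qP => //; lra.
apply: rV_norm_le => // i; rewrite !mxE; apply: qP; [exact: unit_disk_coord..|].
by have := zz i; rewrite !ffunE.
Qed.

(** The projection of the cylinder from the point at height 2 on its axis. *)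
Lemma cylinder_retraction m : exists r : 'rV[R]_m * R -> 'rV[R]_m * R,
  [/\ {within unit_disk R m `*` I, continuous r},
    forall p, (unit_disk R m `*` I) p ->
      (unit_disk R m `*` [set 0] `|` unit_sphere R m `*` I) (r p) &
    forall p, (unit_disk R m `*` [set 0] `|` unit_sphere R m `*` I) p -> r p = p].
Proof.
pose s (p : 'rV[R]_m * R) := Order.max (Num.sqrt (sqnorm2 p.1)) ((2 - p.2) / 2).
pose r (p : 'rV[R]_m * R) := ((s p)^-1 *: p.1, 2 - (2 - p.2) / s p).
have s0 p : (unit_disk R m `*` I) p -> 2^-1 <= s p.
  by case=> _ /in_unit h; rewrite le_max; apply/orP; right; lra.
have cs : continuous s.
  move=> -[z t]; apply: (@continuous_max R ('rV[R]_m * R)%type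
    (fun p => Num.sqrt (sqnorm2 p.1)) (fun p => (2 - p.2) / 2)).
    apply: (@continuous_comp _ _ _ (fun p : 'rV[R]_m * R => sqnorm2 p.1)).
      by apply: continuous_comp; [exact: cvg_fst|exact: sqnorm2_continuous].
    exact: sqrt_continuous.
  apply: cvgM; last exact: cvg_cst.
  by apply: cvgB; [exact: cvg_cst|exact: cvg_snd].
exists r; split.
- apply: within_pair.
    apply: continuous_in_subspaceT => -[z t] /set_mem /s0 sp.
    rewrite /prop_for /continuous_at.
    apply: (@cvgZ _ _ _ (nbhs (z, t)) _ (fun p => (s p)^-1) fst); last exact: cvg_fst.
    by apply: cvgV; [rewrite gt_eqF// (lt_le_trans _ sp)|exact: cs].
  apply: continuous_in_subspaceT => -[z t] /set_mem /s0 sp.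
  apply: cvgB; first exact: cvg_cst.
  apply: cvgM; first by apply: cvgB; [exact: cvg_cst|exact: cvg_snd].
  by apply: cvgV; [rewrite gt_eqF// (lt_le_trans _ sp)|exact: cs].
- move=> [z t] Dzt; have sp := s0 _ Dzt; case: Dzt => /= z1 /in_unit t01.
  have sp0 : 0 < s (z, t) by apply: lt_le_trans sp.
  have sz : sqnorm2 ((s (z, t))^-1 *: z) = sqnorm2 z / s (z, t) ^+ 2.
    by rewrite sqnorm2Z exprVn mulrC.
  have nz := sqnorm2_ge0 z.
  have [le|lt] := leP (Num.sqrt (sqnorm2 z)) ((2 - t) / 2).
    have sE : s (z, t) = (2 - t) / 2 by rewrite /s /= max_r.
    left; split=> /=; last first.
      by rewrite sE invf_div mulrCA divff ?mulr1 ?subrr// gt_eqF//; lra.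
    rewrite /unit_disk /= sz ler_pdivrMr ?exprn_gt0// mul1r.
    rewrite -[leLHS]sqr_sqrtr// ler_pXn2r ?nnegrE ?sqrtr_ge0 ?(ltW sp0)//.
    by rewrite sE.
  have sE : s (z, t) = Num.sqrt (sqnorm2 z) by rewrite /s /= max_l// ltW.
  right; split=> /=.
    by rewrite /unit_sphere/= sz sE sqr_sqrtr// divff// gt_eqF// -sqrtr_gt0 -sE.
  have s1 : s (z, t) <= 1 by rewrite sE -sqrtr1 ler_sqrt.
  apply/in_unit/andP; split; first by rewrite subr_ge0 ler_pdivrMr// sE; lra.
  by rewrite lerBlDr -lerBlDl ler_pdivlMr//; lra.
- move=> [z t] [[/= z1 ->]|[/= z1 /in_unit t01]]; rewrite /r /s /=.
    have h : Num.sqrt (sqnorm2 z) <= 1 by rewrite -[leRHS]sqrtr1 ler_sqrt.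
    by rewrite subr0 divff// max_r// invr1 scale1r mulr1 subrr.
  rewrite z1 sqrtr1 max_l; last lra.
  by rewrite invr1 scale1r mulr1; congr pair; lra.
Qed.

End cylinders.

(** * Cell complexes *)

Section cells.
Variables (R : realType) (S : topologicalType) (K : cw_complex R S).
Local Notation I := (`[0, 1]%classic : set R).
Implicit Types (E : set (cw_cell K)) (e : cw_cell K) (X V : set S).

Lemma open_unit_disk_sub m : open_unit_disk R m `<=` unit_disk R m.
Proof. by move=> x /ltW. Qed.

Lemma unit_disk_split m (z : 'rV[R]_m) :
  unit_disk R m z -> open_unit_disk R m z \/ unit_sphere R m z.
Proof.
rewrite /unit_disk /open_unit_disk /unit_sphere /= le_eqVlt.
by case/orP => [/eqP|]; [right|left].
Qed.

Lemma open_cell_uniq e e' x : cw_open_cell e x -> cw_open_cell e' x -> e = e'.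
Proof. by move=> ex e'x; apply: (cw_disjoint (c := K)) => //; exists x. Qed.

Lemma open_cell0 e : cw_open_cell e (@cw_map _ _ K e 0).
Proof.
exists 0 => //; rewrite /open_unit_disk /sqnorm2 /= big1 ?ltr01// => i _.
by rewrite mxE expr0n.
Qed.

Definition cells E := \bigcup_(e in E) cw_open_cell e.

Lemma cells_mem E e x : cells E x -> cw_open_cell e x -> E e.
Proof. by move=> [e' Ee' e'x] /(open_cell_uniq e'x) <-. Qed.

Definition boundary_closed E := forall e, E e ->
  forall z, unit_sphere R (cw_dim e) z -> cells E (cw_map z).

Lemma boundary_closed_disk E e z : boundary_closed E -> E e ->
  unit_disk R (cw_dim e) z -> cells E (cw_map z).
Proof.
by move=> bE Ee /unit_disk_split[zo|zs]; [exists e => //; exists z|exact: bE zs].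
Qed.

Lemma compact_closed_cell e : compact (cw_closed_cell e).
Proof.
by apply: continuous_compact; [exact: cw_map_continuous|exact: compact_unit_disk].
Qed.

Lemma closed_closed_cell e : closed (cw_closed_cell e).
Proof.
by apply: compact_closed; [exact: cw_hausdorff K|exact: compact_closed_cell].
Qed.

(** The closed disk is the closure of the open one. *)
Lemma closed_contains_closed_cell X e z : closed X -> cw_open_cell e `<=` X ->
  unit_disk R (cw_dim e) z -> X (cw_map z).
Proof.
move=> clX eX Dz; apply: contrapT => nX.
have nb : nbhs (cw_map z) (~` X).
  by apply: open_nbhs_nbhs; split=> //; exact: closed_openC.
have /subspace_continuousP/(_ _ Dz _ nb) := @cw_map_continuous _ _ K e.
rewrite /nbhs/=/within/= => h.
have ct : (fun t : R => t *: z) @ (1:R)^'- --> z.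
  apply: cvg_at_left_filter; rewrite -[X in _ --> X]scale1r.
  by apply: (@cvgZ _ _ _ (nbhs (1:R)) _ id (cst z)); [exact: cvg_id|exact: cvg_cst].
have {}h := ct _ h.
near (1:R)^'- => t.
have t1 : t < 1 by near: t; exact: nbhs_left_lt.
have t0 : 0 < t by near: t; exact: nbhs_left_gt.
have oz : open_unit_disk R _ (t *: z).
  rewrite /open_unit_disk/= sqnorm2Z; apply: (@le_lt_trans _ _ (t ^+ 2)).
    by rewrite ler_piMr// sqr_ge0.
  by rewrite expr_lt1// ltW.
have : ~ X (cw_map (t *: z)).
  have : unit_disk R _ (t *: z) by exact: open_unit_disk_sub.
  by near: t.
by apply; apply: eX; exists (t *: z).
Unshelve. all: by end_near. Qed.

(** Closedness of [B] need only be tested on the cells that [B] may meet: by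
closure-finiteness the boundary of any other cell meets finitely many of them. *)
Lemma closed_in_cells E (B : set S) : boundary_closed E -> B `<=` cells E ->
  (forall e, E e -> closed (B `&` cw_closed_cell e)) -> closed B.
Proof.
move=> bE BE cB; apply: (cw_weak_topology (c := K)) => e.
have [/cB//|nEe] := pselect (E e).
have [F [fF _ sF]] := cw_closure_finite e.
have -> : B `&` cw_closed_cell e =
    (\bigcup_(e' in F `&` E) (B `&` cw_closed_cell e')) `&` cw_closed_cell e.
  apply/seteqP; split=> [x [Bx [z Dz zx]]|x [[e' [Fe' Ee'] []]]] //.
  split; last by exists z.
  have [/unit_disk_split[zo|zs]] := Dz; first by case: nEe; apply: cells_mem (BE _ Bx) _; exists z.
  have [e' Fe' e'x] : (\bigcup_(e' in F) cw_open_cell e') x.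
    by apply: sF; exists z.
  exists e'; first by split=> //; exact: cells_mem (BE _ Bx) e'x.
  by split=> //; case: e'x => w wo <-; exists w => //; exact: open_unit_disk_sub.
apply: closedI; last exact: closed_closed_cell.
rewrite -(bigcup_image _ (fun e' => B `&` cw_closed_cell e') id).
apply: closed_bigcup => [|_ [e' [_ Ee'] <-]]; last exact: cB.
by apply: finite_image; apply: sub_finite_set fF => ? [].
Qed.

Lemma closed_within (U W : topologicalType) (A : set U) (f : U -> W) (C : set W) :
  closed A -> {within A, continuous f} -> closed C -> closed (A `&` f @^-1` C).
Proof.
move=> cA cf cC; rewrite closed_setSI//.
by apply: preimage_closed => // x _; exact: cf.
Qed.

(** A tube around a point of the cylinder: the set [B] of the points of the base
over which a short closed interval leaves [W] is closed, because its trace on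
each closed cell is the image of a compact set. *)
Lemma cellwise_continuous (Y : topologicalType) E (H : S * R -> Y) :
  boundary_closed E ->
  (forall e, E e -> {within unit_disk R (cw_dim e) `*` I,
    continuous (fun p => H (@cw_map _ _ K e p.1, p.2))}) ->
  {within cells E `*` I, continuous H}.
Proof.
move=> bE cH; apply/subspace_continuousP => -[x t] [/= Ex It] W0 W0x.
rewrite /nbhs/=/within/=.
have [W [oW Wx] WW0] : exists2 W : set Y, open W /\ W (H (x, t)) & W `<=` W0.
  by move: W0x; rewrite nbhsE => -[W [? ?] ?]; exists W.
have [e Ee [z zo zx]] := Ex.
have Dz := open_unit_disk_sub zo.
have [d d0 dP] : exists2 d : R, 0 < d &
    forall t', I t' -> `|t - t'| <= d -> W (H (x, t')).
  have /subspace_continuousP/(_ (z, t) (conj Dz It) W) := cH _ Ee.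
  have Wz : nbhs (H (cw_map z, t)) W by apply: open_nbhs_nbhs; rewrite zx.
  move=> /(_ Wz) [[P Q]] /= [Pz Qt] PQ.
  have /nbhs_ballP[d d0 dQ] := Qt.
  exists (d / 2); first by rewrite divr_gt0.
  move=> t' It' tt'; rewrite -zx.
  apply: (PQ (z, t')) => //; split => /=; first exact: nbhs_singleton.
  apply: dQ; rewrite -ball_normE /=; apply: (le_lt_trans tt').
  by rewrite ltr_pdivrMr// ltr_pMr// ltr1n.
pose J := I `&` [set t' | `|t - t'| <= d].
have cJ : compact J.
  apply: compact_closedI; first exact: segment_compact.
  have -> : [set t' | `|t - t'| <= d] = (fun t' => `|t - t'|) @^-1` [set r | r <= d] by [].
  apply: preimage_closed; last exact: closed_le.
  by move=> y _; apply: (@cvg_norm _ R^o); apply: (@cvgB _ R^o); [exact: cvg_cst|exact: cvg_id].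
pose B := [set y | cells E y /\ exists2 t', J t' & ~ W (H (y, t'))].
have cB : closed B.
  apply: (closed_in_cells bE) => [y []//|e' Ee'].
  pose P := (unit_disk R (cw_dim e') `*` J) `&`
    ((unit_disk R (cw_dim e') `*` I) `&`
     (fun p => H (@cw_map _ _ K e' p.1, p.2)) @^-1` (~` W)).
  have cP : compact P.
    apply: compact_closedI.
      by apply: compact_setX => //; exact: compact_unit_disk.
    apply: closed_within; [|exact: cH|exact: open_closedC].
    by apply: closed_setX; [exact: closed_unit_disk|exact: closed_unit].
  have -> : B `&` cw_closed_cell e' = (@cw_map _ _ K e' \o fst) @` P.
    apply/seteqP; split=> [y [[_ [t' Jt' nW]] [w Dw wy]]|_ [[w t'] [[/= Dw Jt'] [_ nW]] <-]].
      rewrite -wy in nW *; exists (w, t') => //.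
      by split=> //; split=> //; split=> //; case: Jt'.
    split; last by exists w.
    by split; [exact: boundary_closed_disk|exists t'].
  apply: compact_closed; first exact: cw_hausdorff K.
  apply: continuous_compact cP.
  apply: (within_comp _ (@within_fst _ _ _) (@cw_map_continuous _ _ K e')).
  by move=> [w t'] [[]].
exists (~` B, [set t' | `|t - t'| <= d]) => /=.
  split; first apply: open_nbhs_nbhs.
    split; first exact: closed_openC.
    by move=> [_ [t' [It' tt'] nW]]; apply: nW; exact: dP.
  apply/nbhs_ballP; exists d => // t'; rewrite -ball_normE /=; exact: ltW.
move=> [y t'] [/= nB tt'] [/= Ey It']; apply: WW0; apply: contrapT => nW.
by apply: nB; split=> //; exists t'.
Qed.

End cells.

(** * Extending maps over the cells of a cylinder *)

Section extend_cells.
Variables (R : realType) (S : topologicalType) (K : cw_complex R S).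
Local Notation I := (`[0, 1]%classic : set R).
Implicit Types (E D : set (cw_cell K)) (e : cw_cell K).

(** [Q] is the part of the time interval over which the map is already given on
the whole disk: the bottom for homotopy extension, both ends when a homotopy is
sought. *)
Definition cylinder_extends (Y : topologicalType) (Q : set R) (m : nat) :=
  forall c : 'rV[R]_m * R -> Y,
    {within unit_disk R m `*` Q `|` unit_sphere R m `*` I, continuous c} ->
  exists2 c', {within unit_disk R m `*` I, continuous c'} &
    forall p, (unit_disk R m `*` Q `|` unit_sphere R m `*` I) p -> c' p = c p.

Lemma cell_point_inj (u v : {e : cw_cell K & 'rV[R]_(cw_dim e)}) :
  open_unit_disk R _ (projT2 u) -> open_unit_disk R _ (projT2 v) ->
  cw_map (projT2 u) = cw_map (projT2 v) -> u = v.
Proof.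
case: u v => [e z] [e' z'] /= oz oz' zz'.
have ee' : e = e'.
  by apply: (@open_cell_uniq _ _ K e e' (cw_map z)); [exists z|exists z'].
case: _ / ee' in z' oz' zz' *.
have [g [_ gK]] := @cw_map_homeo _ _ K e.
by rewrite -(gK z (mem_set oz)) zz' gK//; exact: mem_set.
Qed.

Lemma boundary_closed_skeleton E D n : boundary_closed E -> boundary_closed D ->
  D `<=` E -> boundary_closed [set e | E e /\ (D e \/ (cw_dim e < n)%N)].
Proof.
move=> bE bD DE e [Ee [De|en]] z zs.
  by have [e' De' e'z] := bD _ De _ zs; exists e' => //; split; [exact: DE|left].
have [F [_ Fe sF]] := cw_closure_finite e.
have [e' Fe' e'z] : (\bigcup_(e' in F) cw_open_cell e') (cw_map z).
  by apply: sF; exists z.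
exists e' => //; split; first exact: cells_mem (bE _ Ee _ zs) e'z.
by right; exact: ltn_trans (Fe _ Fe') en.
Qed.

(** The cells are attached in the order of their dimensions, all those of a
given dimension at once. *)
Lemma extend_cells (Y : topologicalType) E D (N : nat) (Q : set R)
    (G : S * R -> Y) :
  boundary_closed E -> boundary_closed D -> D `<=` E -> Q `<=` I -> closed Q ->
  (forall e, E e -> ~ D e -> (cw_dim e < N)%N) ->
  {within cells D `*` I, continuous G} ->
  {within cells E `*` Q, continuous G} ->
  (forall e, E e -> ~ D e -> cylinder_extends Y Q (cw_dim e)) ->
  exists2 H : S * R -> Y, {within cells E `*` I, continuous H} &
    forall p, (cells D `*` I `|` cells E `*` Q) p -> H p = G p.
Proof.
move=> bE bD DE QI cQ dimE cGD cGE ext.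
pose En n := [set e | E e /\ (D e \/ (cw_dim e < n)%N)].
have bEn n : boundary_closed (En n) by exact: boundary_closed_skeleton.
suff /(_ N)[H cH HG] : forall n, exists2 H : S * R -> Y,
    forall e, En n e -> {within unit_disk R (cw_dim e) `*` I,
      continuous (fun p => H (@cw_map _ _ K e p.1, p.2))} &
    forall p, (cells D `*` I `|` cells E `*` Q) p -> H p = G p.
  exists H => //; apply: (cellwise_continuous bE) => e Ee; apply: cH; split=> //.
  by have [De|nDe] := pselect (D e); [left|right; exact: dimE].
elim=> [|n [H cH HG]].
  exists G => // e [Ee [De|//]].
  apply: (within_comp (B := cells D `*` I)) cGD.
    by move=> [z t] [/= Dz It]; split=> //=; exact: boundary_closed_disk.
  apply: within_pair; last exact: within_snd.
  by apply: (within_comp (B := unit_disk R _)) (@cw_map_continuous _ _ K e) => [[z t] []//|]; exact: within_fst.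
have cHn := cellwise_continuous (bEn n) cH.
have cmap e : {within unit_disk R (cw_dim e) `*` setT, continuous
    (fun p : 'rV[R]_(cw_dim e) * R => (@cw_map _ _ K e p.1, p.2))}.
  apply: within_pair; last exact: within_snd.
  by apply: (within_comp (B := unit_disk R _)) (@cw_map_continuous _ _ K e) => [[z t] []//|]; exact: within_fst.
pose new e := [/\ E e, ~ D e & cw_dim e = n].
have sphere_En e z : new e -> unit_sphere R (cw_dim e) z -> cells (En n) (cw_map z).
  move=> [Ee nDe en] zs.
  have [F [_ Fe sF]] := cw_closure_finite e.
  have [e' Fe' e'z] : (\bigcup_(e' in F) cw_open_cell e') (cw_map z).
    by apply: sF; exists z.
  exists e' => //; split; first exact: cells_mem (bE _ Ee _ zs) e'z.
  by right; rewrite -en; exact: Fe.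
have ex e : exists c' : 'rV[R]_(cw_dim e) * R -> Y, new e ->
    {within unit_disk R _ `*` I, continuous c'} /\
    forall p, (unit_disk R _ `*` Q `|` unit_sphere R _ `*` I) p ->
      c' p = H (cw_map p.1, p.2).
  have [[Ee nDe en]|nnew] := pselect (new e); last by exists (fun p => H (cw_map p.1, p.2)).
  pose c (p : 'rV[R]_(cw_dim e) * R) := H (@cw_map _ _ K e p.1, p.2).
  have [|c' cc' c'E] := ext _ Ee nDe c; last by exists c' => _; split.
  apply: withinU_continuous.
  - exact: closed_setX (@closed_unit_disk _ _) cQ.
  - exact: closed_setX (@closed_unit_sphere _ _) (@closed_unit R).
  - pose c0 (p : 'rV[R]_(cw_dim e) * R) := G (@cw_map _ _ K e p.1, p.2).
    have cE p : (unit_disk R _ `*` Q) p -> c0 p = c p.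
      case: p => z t [/= Dz Qt]; rewrite /c HG//; right; split=> //=.
      exact: boundary_closed_disk.
    apply: (within_eq cE).
    apply: (within_comp _ (continuous_subspaceW _ (cmap e)) cGE).
      by move=> [z t] [/= Dz Qt]; split=> //=; exact: boundary_closed_disk.
    by move=> [z t] [].
  - apply: (within_comp _ (continuous_subspaceW _ (cmap e)) cHn).
      by move=> [z t] [/= zs It]; split=> //=; exact: sphere_En.
    by move=> [z t] [/= /unit_sphere_disk].
pose c' e := sval (cid (ex e)).
have c'P e : new e -> {within unit_disk R _ `*` I, continuous (c' e)} /\
    forall p, (unit_disk R _ `*` Q `|` unit_sphere R _ `*` I) p ->
      c' e p = H (cw_map p.1, p.2) := svalP (cid (ex e)).
pose isnew (x : S) (u : {e : cw_cell K & 'rV[R]_(cw_dim e)}) :=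
  [/\ new (projT1 u), open_unit_disk R _ (projT2 u) & cw_map (projT2 u) = x].
(* [c' e], read through the characteristic map, on the new open cells; [H]
   elsewhere *)
pose H1 (p : S * R) := match pselect (exists u, isnew p.1 u) with
  | left h => c' (projT1 (sval (cid h))) (projT2 (sval (cid h)), p.2)
  | right _ => H p end.
have H1new e z t : new e -> open_unit_disk R (cw_dim e) z ->
    H1 (cw_map z, t) = c' e (z, t).
  move=> ne oz; rewrite /H1 /=; case: pselect => [h|[]]; last first.
    by exists (existT _ e z).
  have [_ ou uz] := svalP (cid h).
  by rewrite (@cell_point_inj (sval (cid h)) (existT _ e z)).
have H1old' x t : ~ (exists u, isnew x u) -> H1 (x, t) = H (x, t).
  by rewrite /H1; case: pselect.
have H1old x t : cells (En n) x -> H1 (x, t) = H (x, t).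
  move=> [e [Ee De] ex0]; apply: H1old' => -[[e' z] [[/= Ee' nDe' en'] oz zx]].
  have e'x : cw_open_cell e' x by exists z.
  have ee' := open_cell_uniq ex0 e'x; rewrite {}ee' in De.
  by case: De => //; rewrite en' ltnn.
have D_En : cells D `<=` cells (En n).
  by move=> x [e De ex0]; exists e => //; split; [exact: DE|left].
exists H1; last first.
  move=> [x t] h; have [[[e z] [/= ne oz zx]]|nx] := pselect (exists u, isnew x u).
    rewrite -zx H1new//; have [Ee nDe _] := ne.
    have [_ ->/=] := c'P _ ne; first by rewrite zx HG.
    left; split=> /=; first exact: open_unit_disk_sub.
    case: h => -[/=]; last by [].
    by rewrite -zx => Dx _; case: nDe; apply: cells_mem Dx _; exists z.
  by rewrite H1old'// HG.
move=> e [Ee De].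
have [Ene|nEn] := pselect (En n e).
  apply: within_eq (cH _ Ene) => -[z t] [/= Dz It].
  by rewrite H1old//; exact: boundary_closed_disk.
have ne : new e.
  split=> //; first by move=> D0; apply: nEn; split=> //; left.
  case: De => [D0|]; first by case: nEn; split=> //; left.
  rewrite ltnS leq_eqVlt => /orP[/eqP//|en].
  by case: nEn; split=> //; right.
have [cc' c'E] := c'P _ ne.
apply: within_eq cc' => -[z t] [/= Dz It].
have [oz|zs] := unit_disk_split Dz; first by rewrite H1new.
rewrite H1old; last exact: sphere_En.
by rewrite c'E//; right.
Qed.

End extend_cells.

(** * Extending a map to a homotopy equivalence of homotopy spheres *)

Section cell_extension_problems.
Variable R : realType.
Local Notation I := (`[0, 1]%classic : set R).

Lemma cylinder_extends_bottom (Y : topologicalType) m :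
  cylinder_extends Y [set (0 : R)] m.
Proof.
move=> c cc; have [r [cr rE rid]] := cylinder_retraction R m.
exists (c \o r); first exact: within_comp cr cc.
by move=> p /rid /= ->.
Qed.

Lemma closed_01 : closed [set (0 : R); 1].
Proof.
have -> : [set (0 : R); 1] = [set t | t = 0] `|` [set t | t = 1] by [].
by apply: closedU; exact: closed_eq.
Qed.

Lemma cylinder_extends_sphere m k : (m < k)%N ->
  cylinder_extends (unit_sphere R k.+1) [set (0 : R); 1] m.
Proof.
move=> mk c cc.
have [|F [cF FE]] := sphere_extension (compact_cylinder (R := R) (m := m)) _ (@box_dim_cylinder R m) mk cc.
  apply: closedU; apply: closed_setX.
  - exact: closed_unit_disk.
  - exact: closed_01.
  - exact: closed_unit_sphere.
  - exact: closed_unit.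
by exists F.
Qed.

End cell_extension_problems.

Section homotopy_extension.
Variables (R : realType) (S : topologicalType) (K : cw_complex R S).
Local Notation I := (`[0, 1]%classic : set R).
Implicit Types (X V : set S).

Definition cells_of X : set (cw_cell K) := [set e | cw_open_cell e `<=` X].

Lemma subcomplex_cells X : subcomplex K X -> cells (cells_of X) = X.
Proof.
move=> [_ [E XE]]; apply/seteqP; split=> [x [e eX]|x]; first exact: eX.
rewrite {1}XE => -[e Ee ex]; exists e => //= y ey.
by rewrite XE; exists e.
Qed.

Lemma subcomplex_boundary_closed X : subcomplex K X -> boundary_closed (cells_of X).
Proof.
move=> sX e eX z zs; rewrite subcomplex_cells//.
by apply: closed_contains_closed_cell eX (unit_sphere_disk zs); case: sX.
Qed.

(** The data are [h] at time 0 over [X] and the given homotopy over [V]; a cylinder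
retracts to its bottom and its side, so that no cell obstructs the extension. *)
Lemma homotopy_extension (Y : topologicalType) X V (N : nat) (h f : S -> Y) :
  subcomplex K X -> subcomplex K V -> V `<=` X ->
  (forall e, cells_of X e -> (cw_dim e <= N)%N) ->
  {within X, continuous h} -> homotopic_on R V h f ->
  exists F, [/\ {within X, continuous F}, forall x, V x -> F x = f x &
    homotopic_on R X h F].
Proof.
move=> sX sV VX dimX ch [H0 [cH0 H00 H01]].
pose G (p : S * R) := if pselect (V p.1) then H0 p else h p.1.
have [|||||||||H cH HG] := @extend_cells R S K Y (cells_of X) (cells_of V) N.+1 [set 0] G.
- exact: subcomplex_boundary_closed.
- exact: subcomplex_boundary_closed.
- by move=> e /= /subset_trans; exact.
- by move=> _ ->; apply/in_unit; rewrite lexx ler01.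
- exact: closed_eq.
- by move=> e eX _; rewrite ltnS dimX.
- rewrite subcomplex_cells//; apply: within_eq cH0 => -[x t] [/= Vx _].
  by rewrite /G /=; case: pselect.
- rewrite subcomplex_cells//.
  have hG p : (X `*` [set 0]) p -> (h \o fst) p = G p.
    by case: p => x t [/= _ ->]; rewrite /G /=; case: pselect => //= v; rewrite H00.
  apply: (within_eq hG); apply: (within_comp _ (@within_fst _ _ _) ch).
  by move=> [x t] [].
- by move=> e _ _; exact: cylinder_extends_bottom.
rewrite !subcomplex_cells// in cH HG *.
exists (fun x => H (x, 1)); split.
- apply: (within_comp _ _ cH); first by move=> x Xx; split=> //=; apply/in_unit; rewrite ler01 lexx.
  apply: within_pair; apply: continuous_subspaceT => x; [exact: cvg_id|exact: cvg_cst].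
- move=> x Vx; rewrite HG; last by left; split=> //=; apply/in_unit; rewrite ler01 lexx.
  by rewrite /G /=; case: pselect => // v; rewrite H01.
- exists H; split=> // x Xx; rewrite HG; last by right.
  by rewrite /G /=; case: pselect => // v; rewrite H00.
Qed.

(** The cylinder over a cell of [V] has dimension at most [k], hence maps given
on its boundary with values in [S^k] extend. *)
Lemma sphere_maps_homotopic V (k : nat) (f g : S -> unit_sphere R k.+1) :
  subcomplex K V -> (forall e, cells_of V e -> (cw_dim e < k)%N) ->
  {within V, continuous f} -> {within V, continuous g} -> homotopic_on R V f g.
Proof.
move=> sV dimV cf cg.
pose G (p : S * R) := if p.2 == 0 then f p.1 else g p.1.
have c0 : cells (set0 : set (cw_cell K)) = set0 by rewrite /cells bigcup_set0.
have [|||||||||H cH HG] := @extend_cells R S K _ (cells_of V) set0 k [set 0; 1] G.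
- exact: subcomplex_boundary_closed.
- by [].
- by [].
- by move=> t [->|->]; apply/in_unit; rewrite lexx ler01.
- exact: closed_01.
- by move=> e eV _; exact: dimV.
- by rewrite c0 set0X; exact: continuous_subspace0.
- rewrite subcomplex_cells//.
  pose at_ (a : R) : set (S * R) := snd @^-1` [set t | t = a].
  have cat a : closed (at_ a).
    by apply: preimage_closed; [move=> -[x t] _; exact: cvg_snd|exact: closed_eq].
  apply: (within_paste (cat 0) (cat 1)); first by move=> [x t] [].
    have fG p : (V `*` [set 0; 1] `&` at_ 0) p -> (f \o fst) p = G p.
      by case: p => x t [_]; rewrite /at_ /G /= => ->; rewrite eqxx.
    apply: (within_eq fG); apply: (within_comp _ (@within_fst _ _ _) cf).
    by move=> [x t] [[]].
  have gG p : (V `*` [set 0; 1] `&` at_ 1) p -> (g \o fst) p = G p.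
    by case: p => x t [_]; rewrite /at_ /G /= => ->; rewrite oner_eq0.
  apply: (within_eq gG); apply: (within_comp _ (@within_fst _ _ _) cg).
  by move=> [x t] [[]].
- by move=> e eV _; apply: cylinder_extends_sphere; exact: dimV.
rewrite subcomplex_cells// c0 in cH HG.
exists H; split=> // x Vx; rewrite HG /G /= ?eqxx ?oner_eq0//.
- by right; split=> //; left.
- by right; split=> //; right.
Qed.

End homotopy_extension.

Lemma homotopy_sphere_nonempty (R : realType) (S : topologicalType)
    (K : cw_complex R S) (X : set S) (k : nat) : homotopy_sphere K k X -> X !=set0.
Proof.
move=> [_ [[_ [e [eX _]]] _]]; exists (@cw_map _ _ K e 0); apply: eX.
exact: open_cell0.
Qed.

(** No degree has to be computed: any homotopy equivalence [h] from [X] to [Y]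
restricts on [V] to a map homotopic to [f], since [V] has too small a dimension
to carry two classes of maps into a sphere, and by homotopy extension [h] can
then be deformed into an extension of [f]. *)
Lemma extend_to_equivalence (R : realType) (S T : topologicalType)
    (K : cw_complex R S) (K' : cw_complex R T) (X V : set S) (Y : set T)
    (k : nat) (f : S -> T) :
  homotopy_sphere K k X -> homotopy_sphere K' k Y ->
  subcomplex K V -> V `<=` X ->
  (forall e : cw_cell K, cw_open_cell e `<=` V -> (cw_dim e < k)%N) ->
  {within V, continuous f} -> (forall x, V x -> Y (f x)) ->
  exists F, [/\ {within X, continuous F}, forall x, V x -> F x = f x &
    homotopy_equivalence_on R X Y F].
Proof.
move=> hX hY sV VX dimV cf fVY.
have [y Yy] := homotopy_sphere_nonempty hY.
pose y0 : Y := exist _ y (mem_set Yy).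
have [sX [[dimX _] [hx ehx]]] := hX; have [_ [_ [a ea]]] := hY.
have [b [eb ba _]] := homotopy_equivalence_sym ea.
pose h := b \o hx.
have eh : homotopy_equivalence R h by exact: homotopy_equivalence_comp.
pose h' : S -> Y := valL_ y0 h.
have ch' : {within X, continuous h'} by apply/subspace_valL_continuousP'; case: eh.
have h'E : h' \o set_val = h by exact: valLK.
pose f' (x : S) : Y := insubd y0 (f x).
have f'E x : V x -> set_val (f' x) = f x.
  by move=> Vx; apply: (insubdK y0); apply/mem_set; exact: fVY.
have cf' : {within V, continuous f'}.
  by apply: within_set_type; apply: within_eq cf => x Vx /=; rewrite f'E.
have ch'V : {within V, continuous h'} by exact: continuous_subspaceW ch'.
have ca : continuous a by case: ea.
have cb : continuous b by case: eb.
have comp_cont (g : S -> Y) : {within V, continuous g} -> {within V, continuous (a \o g)}.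
  by move=> cg; apply: (within_comp (B := setT) _ cg) => //; exact: continuous_subspaceT.
(* [a] and [b] are inverse homotopy equivalences between [Y] and the sphere, and
   [h' ~ b a h' ~ b a f' ~ f'] on [V]. *)
have h'f' : homotopic_on R V h' f'.
  have baV (g : S -> Y) : {within V, continuous g} -> homotopic_on R V (b \o a \o g) g.
    move=> cg; apply: (@homotopic_on_compr R _ _ _ V setT (b \o a) id g) => //.
    exact/homotopic_onT.
  apply: (homotopic_on_trans (g := b \o a \o h')); first exact/homotopic_on_sym/baV.
  apply: homotopic_on_trans (baV f' cf').
  apply: (homotopic_on_compl (f := a \o h') (g := a \o f') cb).
  by apply: (sphere_maps_homotopic sV dimV); exact: comp_cont.
have [F [cF FV hF]] := homotopy_extension sX sV VX dimX ch' h'f'.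
exists (set_val \o F); split.
- apply: (within_comp (B := setT) _ cF) => //.
  by apply: continuous_subspaceT; exact: set_val_continuous.
- by move=> x Vx /=; rewrite FV// f'E.
- exists (F \o set_val); split=> //.
  apply: homotopy_equivalence_homotopic eh.
    exact/(@subspace_sigL_continuousP _ X).
  rewrite -h'E; apply/homotopic_onT; apply: homotopic_on_compr hF.
    by apply: continuous_subspaceT; exact: set_val_continuous.
  by move=> x _; exact: set_valP.
Qed.

(** * The intersection lattice of an arrangement *)

Section extremal.
Variables (L : eqType) (r : rel L).
Hypotheses (r_irr : irreflexive r) (r_trans : transitive r).

Lemma seq_extremal (s : seq L) x : x \in s ->
  exists2 m, m \in s & forall y, y \in s -> ~~ r m y.
Proof.
elim: s x => [//|a [|b s] IH] x _.
  by exists a; rewrite ?mem_head// => y; rewrite inE => /eqP ->; rewrite r_irr.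
have [m ms mP] := IH b (mem_head _ _).
have [rma|nrma] := boolP (r m a).
  exists a; first exact: mem_head.
  move=> y; rewrite inE => /orP[/eqP ->|ys]; first by rewrite r_irr.
  by apply/negP => /(r_trans rma); apply/negP; exact: mP.
exists m; first by rewrite inE ms orbT.
by move=> y; rewrite inE => /orP[/eqP ->//|]; exact: mP.
Qed.

End extremal.

Section lattice.
Variables (S : Type) (A : set (set S)).
Local Notation L := (intersection_lattice A).
Implicit Types X Y Z : L.

Lemma isect_leP X Y : reflect (isect_set Y `<=` isect_set X) (X <= Y)%O.
Proof. exact: asboolP. Qed.

Lemma is_intersection1 (Y : set S) : A Y -> is_intersection A Y.
Proof. by move=> AY; exists [set Y]; [move=> _ ->|rewrite bigcap_set1]. Qed.

Lemma is_intersectionT : is_intersection A setT.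
Proof. by exists set0; rewrite ?bigcap_set0. Qed.

Definition isectT : L := Intersection is_intersectionT.

Lemma isectT_le X : (isectT <= X)%O.
Proof. exact/isect_leP. Qed.

Lemma finite_lattice : finite_set A -> exists s : seq L, forall X, X \in s.
Proof.
move=> /finite_seqP[s As].
have sub m : is_intersection A (\bigcap_(H in [set` mask m s]) H).
  by exists [set` mask m s] => // Y /mem_mask; rewrite As.
(* [m] selects a subfamily of [A] among its members listed in [s]. *)
exists [seq Intersection (sub (val m)) | m <- enum {: (size s).-tuple bool}] => X.
have [F FA XE] := isect_proof X.
pose m := [tuple of map (fun H : set S => `[< F H >]) (in_tuple s)].
apply/mapP; exists m; first exact: mem_enum.
apply: isect_set_inj; rewrite XE /= -filter_mask; congr bigcap.
apply/seteqP; split=> [Y FY|Y] /=; rewrite mem_filter.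
  by apply/andP; split; [exact/asboolP|have := FA _ FY; rewrite As].
by case/andP => /asboolP.
Qed.

Lemma finite_lattice_max (p : pred L) X : finite_set A -> p X ->
  exists2 M, p M & forall Y, p Y -> ~~ (M < Y)%O.
Proof.
move=> /finite_lattice[s sT] pX.
have Xs : X \in [seq Y <- s | p Y] by rewrite mem_filter pX sT.
have [M + Mmax] := seq_extremal (@lt_irreflexive _ _) (@lt_trans _ _) Xs.
rewrite mem_filter => /andP[pM _]; exists M => // Y pY.
by apply: Mmax; rewrite mem_filter pY sT.
Qed.

Lemma finite_lattice_ind (P : L -> Prop) : finite_set A ->
  (forall X, (forall Y, (Y < X)%O -> P Y) -> P X) -> forall X, P X.
Proof.
move=> /finite_lattice[s sT] IH X; apply: contrapT => nPX.
pose bad := [seq Y <- s | ~~ `[< P Y >]].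
have Xb : X \in bad by rewrite mem_filter sT andbT; apply/asboolP.
have gt_trans : transitive (fun Y Z : L => (Z < Y)%O).
  by move=> Y Z W ZY YW; exact: lt_trans YW ZY.
have gt_irr : irreflexive (fun Y Z : L => (Z < Y)%O) by move=> Y; exact: ltxx.
have [M + Mmin] := seq_extremal gt_irr gt_trans Xb.
rewrite mem_filter => /andP[/asboolP nPM _]; apply: nPM; apply: IH => Y YM.
apply: contrapT => nPY; have : Y \in bad by rewrite mem_filter sT andbT; apply/asboolP.
by move/Mmin; rewrite YM.
Qed.

Lemma lt_isect X Z : (X < Z)%O -> exists Y : set S,
  [/\ A Y, isect_set Z `<=` Y & ~ isect_set X `<=` Y].
Proof.
move=> XZ; apply: contrapT => nY.
have [F FA ZE] := isect_proof Z.
suff : (Z <= X)%O by rewrite lt_geF.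
apply/isect_leP; rewrite ZE => x Xx Y FY; apply: contrapT => nYx; apply: nY.
exists Y; split; [exact: FA|by rewrite ZE; exact: bigcap_inf|].
by move=> XY; apply/nYx/XY.
Qed.

(** Intersecting [Z] with a member that contains [X] but not [Z] gives an element
strictly above [Z] and below [X], which can only be [X]. *)
Lemma cover_isect Z X : (Z < X)%O -> (forall W, (W < X)%O -> ~~ (Z < W)%O) ->
  exists Y : set S, [/\ A Y, isect_set X = isect_set Z `&` Y & ~ isect_set Z `<=` Y].
Proof.
move=> ZX cov; have [Y [AY XY nZY]] := lt_isect ZX.
exists Y; split=> //.
pose W : L := Intersection (is_intersectionI Z (Intersection (is_intersection1 AY))).
have ZW : (Z < W)%O.
  rewrite lt_neqAle; apply/andP; split; last by apply/isect_leP => x [].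
  by apply/eqP => ZW; apply: nZY => x; rewrite ZW => -[].
have WX : (W <= X)%O.
  apply/isect_leP => x Xx; split; last exact: XY.
  by have /isect_leP := ltW ZX; exact.
move: WX; rewrite le_eqVlt => /orP[/eqP <- //|/cov].
by rewrite ZW.
Qed.

End lattice.

(** * Subcomplexes, and equivalences between subsets *)

Section homotopy_spheres.
Variables (R : realType) (S : topologicalType) (K : cw_complex R S).
Implicit Types (X Y : set S).

Lemma homotopy_sphere_uniq (k l : int) X :
  homotopy_sphere K k X -> homotopy_sphere K l X -> k = l.
Proof.
case: k => [k|[|k]]; case: l => [l|[|l]] //.
- move=> [_ [[k1 [e [eX ek]]] _]] [_ [[l1 [e' [eX' el]]] _]].
  congr Posz; apply/eqP; rewrite eqn_leq; apply/andP; split.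
    by rewrite -ek; exact: l1.
  by rewrite -el; exact: k1.
- by move=> /homotopy_sphere_nonempty[x Xx] [_ X0]; rewrite X0 in Xx.
- by move=> _ [].
- by move=> [_ X0] /homotopy_sphere_nonempty[x]; rewrite X0.
- by move=> _ [].
- by case.
- by case.
- by case.
Qed.

Lemma subcomplex_cell_sub X (e : cw_cell K) x :
  subcomplex K X -> X x -> cw_open_cell e x -> cw_open_cell e `<=` X.
Proof.
move=> [_ [E XE]] Xx ex y ey; rewrite XE in Xx *.
by exists e => //; exact: cells_mem Xx ex.
Qed.

Lemma subcomplex_bigsetU (J : Type) (s : seq J) (F : J -> set S) :
  (forall j, subcomplex K (F j)) -> subcomplex K (\big[setU/set0]_(j <- s) F j).
Proof.
move=> sF; elim/big_ind: _ => // [|X Y [cX [E XE]] [cY [E' YE]]].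
  by split; [exact: closed0|exists set0; rewrite bigcup_set0].
split; first exact: closedU.
by exists (E `|` E'); rewrite bigcup_setU XE YE.
Qed.

End homotopy_spheres.

Lemma within_bigsetU (U V : topologicalType) (J : Type) (s : seq J)
    (F : J -> set U) (p : pred J) (f : U -> V) : (forall j, closed (F j)) ->
  (forall j, p j -> {within F j, continuous f}) ->
  {within \big[setU/set0]_(j <- s | p j) F j, continuous f}.
Proof.
move=> cF cf; suff [] : closed (\big[setU/set0]_(j <- s | p j) F j) /\
  {within \big[setU/set0]_(j <- s | p j) F j, continuous f} by [].
elim/big_ind: _ => [|X Y [cX fX] [cY fY]|j pj].
- by split; [exact: closed0|exact: continuous_subspace0].
- by split; [exact: closedU|exact: withinU_continuous].
- by split=> //; exact: cf.
Qed.

Section equivalence_on.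
Variable R : realType.

Lemma homotopy_equivalence_on_eq (S T : topologicalType) (X : set S) (Y : set T)
    (f g : S -> T) : (forall x, X x -> f x = g x) ->
  homotopy_equivalence_on R X Y f -> homotopy_equivalence_on R X Y g.
Proof.
move=> fg [h [hf eh]]; exists h; split=> // x.
by rewrite hf fg//; exact: set_valP.
Qed.

Lemma homotopy_equivalence_on_sub (S T : topologicalType) (X : set S) (Y : set T)
    (f : S -> T) : homotopy_equivalence_on R X Y f -> forall x, X x -> Y (f x).
Proof.
move=> [h [hf _]] x Xx.
have := hf (exist _ x (mem_set Xx)); rewrite [in RHS]set_valE /= => <-.
exact: set_valP.
Qed.

Lemma homotopy_equivalence_on0 (S T : topologicalType) (X : set S) (Y : set T)
    (f : S -> T) : X = set0 -> Y = set0 -> homotopy_equivalence_on R X Y f.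
Proof.
move=> -> ->.
have nX (x : (set0 : set S)) : False := set_valP x.
have nY (y : (set0 : set T)) : False := set_valP y.
exists (fun x => False_rect _ (nX x)); split=> [x|]; first by case: (nX x).
apply: (@homeomorphism_equivalence _ _ _ _ (fun y => False_rect _ (nY y))).
- by move=> x; case: (nX x).
- by move=> y; case: (nY y).
- by move=> x; case: (nX x).
- by move=> y; case: (nY y).
Qed.

Lemma set_valT_equivalence (S : topologicalType) :
  homotopy_equivalence R (set_val : [set: S] -> S) /\
  homotopy_equivalence R (fun x : S => exist _ x (mem_set I) : [set: S]).
Proof.
have c : continuous (fun x : S => exist _ x (mem_set I) : [set: S]).
  apply/continuous_subspace_setT; apply: within_set_type.
  by apply: continuous_subspaceT => x; exact: cvg_id.
have c' := @set_val_continuous S setT.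
have K1 : cancel (set_val : [set: S] -> S) (fun x => exist _ x (mem_set I)).
  by move=> x; apply: val_inj.
by split; [apply: homeomorphism_equivalence c' c _ _|apply: homeomorphism_equivalence c c' _ _].
Qed.

Lemma homotopy_equivalence_onT (S T : topologicalType) (X : set S) (Y : set T)
    (f : S -> T) : X = setT -> Y = setT ->
  homotopy_equivalence_on R X Y f -> homotopy_equivalence R f.
Proof.
move=> -> -> [h [hf eh]].
have -> : f = (set_val \o h) \o (fun x : S => exist _ x (mem_set I) : [set: S]).
  by apply/funext => x /=; rewrite hf.
apply: homotopy_equivalence_comp; first exact: (set_valT_equivalence S).2.
by apply: homotopy_equivalence_comp; last exact: (set_valT_equivalence T).1.
Qed.

End equivalence_on.

(** * Arrangements with isomorphic lattices *)

Section arrangement.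
Variables (R : realType) (d : int) (S : topologicalType) (K : cw_complex R S).
Variables (A : set (set S)).
Hypothesis hA : sphere_arrangement d K A.
Local Notation L := (intersection_lattice A).
Implicit Types X Y Z : L.

Lemma arrangement_subcomplex X : subcomplex K X.
Proof. by have [k []] := arr_intersection hA (isect_proof X). Qed.

(** The smaller intersection [Z] lies in a section of [X] by a member of the
arrangement, which has dimension [k - 1]. *)
Lemma lt_cell_dim X Z (k : nat) e : homotopy_sphere K k X -> (X < Z)%O ->
  cw_open_cell e `<=` isect_set Z -> (@cw_dim _ _ K e < k)%N.
Proof.
move=> hX XZ eZ; have [H [AH ZH nXH]] := lt_isect XZ.
have eXH : cw_open_cell e `<=` isect_set X `&` H.
  by move=> x /eZ Zx; split; [have /isect_leP := ltW XZ; exact|exact: ZH].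
have := arr_cut hA (isect_proof X) hX AH nXH; case: k hX => [|k] hX.
  by move=> [_ XH0]; have := eXH _ (open_cell0 e); rewrite XH0.
by rewrite -addn1 PoszD addrK => -[_ [[dimXH _] _]]; rewrite addn1 ltnS; exact: dimXH.
Qed.

Lemma member_neqT (H : set S) : A H -> H <> setT.
Proof.
move=> AH HT; have := arr_member hA AH; rewrite HT.
by move=> /(homotopy_sphere_uniq (arr_ambient hA)); lia.
Qed.

(** A member strictly inside another one would be cut out of it, hence would have
codimension two. *)
Lemma member_maximal (H : set S) Z : A H -> H `<=` isect_set Z ->
  isect_set Z <> setT -> isect_set Z = H.
Proof.
move=> AH HZ ZT.
have TZ : (isectT A < Z)%O.
  by rewrite lt_neqAle isectT_le andbT; apply/eqP => TZ; apply: ZT; rewrite -TZ.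
have [H' [AH' ZH' _]] := lt_isect TZ.
have [H'H|nH'H] := pselect (H' `<=` H).
  by apply/seteqP; split=> //; exact: subset_trans H'H.
have := arr_cut hA (is_intersection1 AH') (arr_member hA AH') AH nH'H.
have -> : H' `&` H = H by apply/setIidPr; exact: subset_trans ZH'.
by move=> /(homotopy_sphere_uniq (arr_member hA AH)); lia.
Qed.

End arrangement.

Section isomorphic_arrangements.
Variables (R : realType) (d : int) (S T : topologicalType).
Variables (K : cw_complex R S) (K' : cw_complex R T).
Variables (A : set (set S)) (B : set (set T)).
Hypotheses (hA : sphere_arrangement d K A) (hB : sphere_arrangement d K' B).
Local Notation LA := (intersection_lattice A).
Local Notation LB := (intersection_lattice B).
Variables (phi : LA -> LB) (psi : LB -> LA).
Hypotheses (phiK : cancel phi psi) (psiK : cancel psi phi).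
Hypothesis phi_mono : {mono phi : X Y / (X <= Y)%O}.
Implicit Types X Y Z : LA.

Let phi_lt X Y : (phi X < phi Y)%O = (X < Y)%O.
Proof. by rewrite !lt_neqAle phi_mono (can_eq phiK). Qed.

Lemma iso_top X : isect_set X = setT -> isect_set (phi X) = setT.
Proof.
move=> XT; have : (phi X <= isectT B)%O.
  by rewrite -(psiK (isectT B)) phi_mono; apply/isect_leP; rewrite XT.
by move=> /isect_leP /= h; apply/seteqP; split.
Qed.

(** Each step down a maximal chain lowers the dimension by one on both sides. *)
Lemma iso_dimension X :
  exists k, homotopy_sphere K k X /\ homotopy_sphere K' k (phi X).
Proof.
move: X; apply: (finite_lattice_ind (arr_finite hA)) => X IH.
have [XT|XT] := pselect (isect_set X = setT).
  exists d; rewrite (iso_top XT) XT.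
  by split; [exact: arr_ambient hA|exact: arr_ambient hB].
have TX : (isectT A < X)%O.
  by rewrite lt_neqAle isectT_le andbT; apply/eqP => TX; apply: XT; rewrite -TX.
have [Z ZX Zmax] := finite_lattice_max (p := fun Z => (Z < X)%O) (arr_finite hA) TX.
have [k [hZ hpZ]] := IH _ ZX.
have [H [AH XE nZH]] := cover_isect ZX Zmax.
have phiZX : (phi Z < phi X)%O by rewrite phi_lt.
have [|H' [BH' pXE nZH']] := cover_isect phiZX.
  by move=> W; rewrite -(psiK W) !phi_lt; exact: Zmax.
exists (k - 1); rewrite XE pXE; split.
  exact: (arr_cut hA (isect_proof Z)).
exact: (arr_cut hB (isect_proof (phi Z))).
Qed.

(** A member is an atom of the lattice.  Its image lies in some member [G] of [B],
and the preimage of [G], which contains it, can only be the member itself. *)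
Lemma iso_member (H : set S) (AH : A H) :
  B (isect_set (phi (Intersection (is_intersection1 AH)))).
Proof.
set X := Intersection _.
have XT : isect_set X <> setT by exact: (member_neqT hA AH).
have pXT : isect_set (phi X) <> setT.
  move=> pXT; apply: XT; apply/seteqP; split=> //.
  suff /isect_leP : (X <= isectT A)%O by [].
  by rewrite -phi_mono; apply/isect_leP; rewrite pXT.
have TX : (isectT B < phi X)%O.
  by rewrite lt_neqAle isectT_le andbT; apply/eqP => TX; apply: pXT; rewrite -TX.
have [G [BG XG _]] := lt_isect TX.
pose Y : LB := Intersection (is_intersection1 BG).
have YX : (psi Y <= X)%O by rewrite -phi_mono psiK; apply/isect_leP.
have pYT : isect_set (psi Y) <> setT.
  move=> /iso_top; rewrite psiK; exact: (member_neqT hB BG).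
have XY : psi Y = X.
  apply: isect_set_inj; apply: (member_maximal hA AH) => //.
  by move/isect_leP: YX.
by rewrite -XY psiK.
Qed.

Lemma iso_card_le : (A #<= B)%card.
Proof.
pose f (G : set T) := match pselect (is_intersection B G) with
  | left p => isect_set (psi (Intersection p)) | right _ => set0 end.
apply: card_le_trans (card_image_le f B); apply: subset_card_le => H AH.
exists (isect_set (phi (Intersection (is_intersection1 AH)))); first exact: iso_member.
rewrite /f; case: pselect => [p|[]]; last exact: isect_proof.
rewrite (_ : Intersection p = phi (Intersection (is_intersection1 AH))) ?phiK//.
exact: isect_set_inj.
Qed.

(** The map is built on one intersection after another, the smaller sets first:
the values on the proper sub-intersections of [X] are already there. *)
Lemma iso_map_on (f0 : S -> T) (s : seq LA) :
  (forall X Y, X \in s -> (X <= Y)%O -> Y \in s) ->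
  exists f : S -> T, forall X, X \in s ->
    {within X, continuous f} /\ homotopy_equivalence_on R X (phi X) f.
Proof.
have [n] := ubnP (size s); elim: n s => // n IH [_ _|X0 s0]; first by exists f0.
set s := X0 :: s0 => ns s_up.
have gt_trans : transitive (fun Y Z : LA => (Z < Y)%O).
  by move=> Y Z W ZY YW; exact: lt_trans YW ZY.
have gt_irr : irreflexive (fun Y Z : LA => (Z < Y)%O) by move=> Y; exact: ltxx.
(* The lattice order being reverse inclusion, [X] is maximal in [s] as a set, so
   that [s] without [X] still contains every sub-intersection of its elements. *)
have [X Xs Xmin] := seq_extremal gt_irr gt_trans (mem_head X0 s0).
pose s' := [seq Y <- s | Y != X].
have [||f fP] := IH s'.
- rewrite -ltnS (leq_trans _ ns)// ltnS size_filter -(count_predC (fun Y => Y != X) s).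
  by rewrite -[ltnLHS]addn0 ltn_add2l -has_count; apply/hasP; exists X => //=; rewrite eqxx.
- move=> Y Z; rewrite !mem_filter => /andP[YX Ys] YZ; rewrite (s_up _ _ Ys YZ) andbT.
  apply: contra (Xmin _ Ys) => /eqP ZX.
  by rewrite lt_neqAle YX -ZX.
(* the part of [X] on which the map is already defined *)
pose V := \big[setU/set0]_(Z <- s | (X < Z)%O) isect_set Z.
have VP x : V x <-> exists2 Z, (X < Z)%O & isect_set Z x.
  rewrite /V -bigcup_seq_cond; split=> [[Z /andP[_ XZ] Zx]|[Z XZ Zx]]; first by exists Z.
  by exists Z => //=; rewrite XZ andbT; exact: s_up (ltW XZ).
have in_s' Z : (X < Z)%O -> Z \in s'.
  by move=> XZ; rewrite mem_filter (s_up _ _ Xs (ltW XZ)) andbT gt_eqF.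
have VX : V `<=` X.
  by move=> x /VP[Z /ltW /isect_leP]; exact.
have sV : subcomplex K V.
  rewrite /V -big_filter; apply: subcomplex_bigsetU => Z.
  exact: (arrangement_subcomplex hA).
have cfV : {within V, continuous f}.
  apply: within_bigsetU => Z; first by case: (arrangement_subcomplex hA Z).
  by move=> /in_s' /fP[].
have fV x : V x -> isect_set (phi X) (f x).
  move=> /VP[Z XZ Zx]; have [_ /homotopy_equivalence_on_sub fZ] := fP _ (in_s' _ XZ).
  have : (phi X <= phi Z)%O by rewrite phi_mono ltW.
  by move=> /isect_leP; apply; exact: fZ.
have [F [cF FV eF]] : exists F, [/\ {within X, continuous F},
    forall x, V x -> F x = f x & homotopy_equivalence_on R X (phi X) F].
  have [[k|k] [hX hpX]] := iso_dimension X.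
    apply: (extend_to_equivalence hX hpX sV VX) => // e eV.
    have [Z XZ Zx] := (VP _).1 (eV _ (open_cell0 e)).
    apply: (lt_cell_dim hA hX XZ).
    exact: subcomplex_cell_sub (arrangement_subcomplex hA Z) Zx (open_cell0 e).
  case: k hX hpX => [[_ Xe] [_ pXe]|k []//].
  exists f; split=> //; first by rewrite Xe; exact: continuous_subspace0.
  exact: homotopy_equivalence_on0.
pose g x := if pselect (isect_set X x) then F x else f x.
exists g => Y Ys; have [->|YX] := eqVneq Y X.
  have Fg x : isect_set X x -> F x = g x by rewrite /g; case: pselect.
  by split; [exact: within_eq cF|exact: homotopy_equivalence_on_eq eF].
(* A point of [Y] in [X] lies in their intersection, which is strictly inside
   [X], hence in [V]: there [F] extends [f]. *)
have fg x : isect_set Y x -> f x = g x.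
  rewrite /g; case: pselect => // Xx Yx; rewrite FV//; apply/VP.
  exists (Intersection (is_intersectionI X Y)); last by split.
  rewrite lt_neqAle; apply/andP; split; last by apply/isect_leP => y [].
  apply/eqP => XE; have := Xmin _ Ys; rewrite lt_neqAle YX /= => /negP; apply.
  by apply/isect_leP => y; rewrite XE => -[].
have [|cf ef] := fP Y; first by rewrite mem_filter YX.
by split; [exact: within_eq cf|exact: homotopy_equivalence_on_eq ef].
Qed.

Lemma iso_map : exists f : S -> T, homotopy_equivalence R f /\
  forall X, homotopy_equivalence_on R X (phi X) f.
Proof.
have [f0] : inhabited (S -> T).
  have [[x]|nS] := pselect (inhabited S); last first.
    by constructor => x; case: nS.
  have := arr_ambient hA; have := arr_ambient hB.
  case: d => [k /homotopy_sphere_nonempty[y _] _|[|k] _ [_ //]].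
    by constructor => _; exact: y.
  by move=> S0; have : [set: S] x by []; rewrite S0.
have [s sT] := finite_lattice (arr_finite hA).
have [//|f fP] := @iso_map_on f0 s.
exists f; split=> [|X]; last by case: (fP X).
have [//|_ efT] := fP (isectT A).
by apply: homotopy_equivalence_onT efT => //; exact: iso_top.
Qed.

End isomorphic_arrangements.

Theorem theorem6p4 (R : realType) (d : int) (S T : topologicalType)
    (K : cw_complex R S) (K' : cw_complex R T)
    (A : set (set S)) (B : set (set T))
    (hA : sphere_arrangement d K A) (hB : sphere_arrangement d K' B)
    (eA : essential A) (eB : essential B)
    (hL : exists phi :
        {lmorphism intersection_lattice A -> intersection_lattice B},
      bijective phi) :
  homotopy_equivalent_arrangements R A B.
Proof.
have [phi [psi phiK psiK]] := hL.
have phi_mono : {mono phi : X Y / (X <= Y)%O}.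
  by move=> X Y; rewrite !leEmeet -omorphI (can_eq phiK).
have psi_mono : {mono psi : X Y / (X <= Y)%O}.
  by move=> X Y; rewrite -phi_mono !psiK.
split.
  rewrite card_eq_le (iso_card_le hA hB phiK psiK phi_mono).
  exact: (iso_card_le hB hA psiK phiK psi_mono).
have [f [ef fP]] := iso_map hA hB phiK psiK phi_mono.
have [g [eg gP]] := iso_map hB hA psiK phiK psi_mono.
by exists phi, psi, f, g.
Qed.
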